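(* Let $d\geq 2$, let $T$ be the $d$-regular rooted tree, and let $G\leq\operatorname{Aut}(T)$ be a finitely generated, self-similar, super strongly self-replicating branch group with both the subgroup induction property and the congruence subgroup property. Then $\operatorname{Sub}(G)$ has Cantor–Bendixson rank $\omega$.
   Context: $\operatorname{Sub}(G)$ is the space of all subgroups of $G$, with the topology induced from the product topology on $\{0,1\}^G$ (Chabauty topology). For a topological space $Y$, let $Y^{(0)}=Y$, let $Y^{(\alpha+1)}$ be the set of non-isolated points of $Y^{(\alpha)}$, and $Y^{(\lambda)}=\bigcap_{\alpha<\lambda}Y^{(\alpha)}$ for $\lambda$ a limit ordinal; the Cantor–Bendixson rank of $Y$ is the least ordinal $\alpha$ with $Y^{(\alpha)}=Y^{(\alpha+1)}$. The vertices of the $d$-regular rooted tree $T$ are identified with the words in $\{1,\dots,d\}^*$; the root is the empty word, the children of $v$ are $v1,\dots,vd$, and $\mathcal L_n$ is the set of words of length $n$. $\operatorname{Aut}(T)$ is the group of automorphisms of $T$ (fixing the root). For a vertex $v$, $T_v$ is the subtree of all words with prefix $v$. For $g\in\operatorname{Aut}(T)$ and a vertex $v$, the section $\varphi_v(g)\in\operatorname{Aut}(T)$ is the unique automorphism with $g\cdot(vw)=(g\cdot v)(\varphi_v(g)\cdot w)$ for all $w\in T$; $\varphi_v$ is a homomorphism on the stabilizer of $v$. For $G\leq\operatorname{Aut}(T)$ and a set $V$ of vertices, $\operatorname{Stab}_G(V)$ is the pointwise stabilizer of $V$ in $G$. $G$ has the congruence subgroup property if every finite-index subgroup of $G$ contains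 $\operatorname{Stab}_G(\mathcal L_n)$ for some $n$. $G$ is super strongly self-replicating if $\varphi_v(\operatorname{Stab}_G(\mathcal L_n))=G$ for all $n$ and all $v\in\mathcal L_n$. $\operatorname{Rist}_G(v)$ is the subgroup of elements of $G$ acting trivially outside $T_v$, and $\operatorname{Rist}_G(\mathcal L_n)$ is the subgroup generated by all $\operatorname{Rist}_G(v)$, $v\in\mathcal L_n$. $G$ is branch if it acts transitively on every $\mathcal L_n$, all $\operatorname{Rist}_G(v)$ are infinite, and every $\operatorname{Rist}_G(\mathcal L_n)$ has finite index in $G$. $G$ is self-similar if $\varphi_v(G)\leq G$ for all vertices $v$. Let $G$ be self-similar. A class $\mathcal X$ of subgroups of $G$ is inductive if: (A) $\{1\}\in\mathcal X$ and $G\in\mathcal X$; (B) if $H\leq L$ are subgroups of $G$ with $[L:H]$ finite and $H\in\mathcal X$, then $L\in\mathcal X$; (C) if $H$ is a finitely generated subgroup of $\operatorname{Stab}_G(\mathcal L_1)$ and $\varphi_v(H)\in\mathcal X$ for all $v\in\mathcal L_1$, then $H\in\mathcal X$. $G$ has the subgroup induction property if every inductive class of subgroups of $G$ contains every finitely generated subgroup of $G$. *)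

(* Defs.v *)
From HB Require Import structures.
From mathcomp Require Import all_boot.
From mathcomp Require Import mathcomp_extra boolp classical_sets functions.
From mathcomp Require Import cardinality topology.
Set Implicit Arguments.
Unset Strict Implicit.
Unset Printing Implicit Defensive.

Local Open Scope classical_set_scope.

(* Ordinals are presented as well-founded trees: [OSup f] is the supremum of an
   arbitrary family, so a limit ordinal is the supremum of any cofinal family
   of smaller ordinals.  Two trees denote the same ordinal when each is [ole]
   the other. *)
Inductive Ord : Type :=
| OZero
| OSucc (a : Ord)
| OSup (I : Type) (f : I -> Ord).

(* [ole (OSucc a) b] is a < b: the inner fixpoint says that [b] has a successor
   subtree [OSucc b'], reached through suprema only, with a <= b'. *)
Fixpoint ole (a : Ord) : Ord -> Prop :=
  match a with
  | OZero => fun=> True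
  | OSucc a' =>
      fix lt_a' (b : Ord) : Prop :=
        match b with
        | OZero => False
        | OSucc b' => ole a' b'
        | OSup _ f => exists i, lt_a' (f i)
        end
  | OSup _ f => fun b => forall i, ole (f i) b
  end.

Definition omega : Ord := OSup (fun n : nat => iter n OSucc OZero).

Section CantorBendixson.
Context {X : topologicalType}.

Definition derived (Y : set X) : set X := Y `\` isolated Y.

(* Y^(a), for Y carrying the topology induced from X.  Intersecting with Y only
   matters for the supremum of the empty family, which is zero. *)
Fixpoint cb_derivative (Y : set X) (a : Ord) : set X :=
  match a with
  | OZero => Y
  | OSucc b => derived (cb_derivative Y b)
  | OSup _ f => Y `&` \bigcap_i cb_derivative Y (f i)
  end.

Definition has_cb_rank (Y : set X) (a : Ord) : Prop :=
  cb_derivative Y a = cb_derivative Y (OSucc a) /\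
  forall b, cb_derivative Y b = cb_derivative Y (OSucc b) -> ole a b.

End CantorBendixson.

Section Subgroups.
Context {gT : groupType}.
Implicit Types G H L : set gT.
Local Open Scope group_scope.

Definition subgroup H : Prop := group_closed [in H].

Definition subgroup_of H G : Prop := subgroup H /\ H `<=` G.

Definition generated (S : set gT) : set gT := smallest subgroup S.

Definition finitely_generated H : Prop :=
  exists2 S : set gT, finite_set S & H = generated S.

Definition left_coset (x : gT) H : set gT := [set x * h | h in H].

(* [L : H] is finite; meaningful when H is a subgroup of L. *)
Definition finite_index H L : Prop :=
  finite_set [set left_coset x H | x in L].

(* Sub(G), as indicator functions in {0,1}^G with the product topology. *)
Definition subgroup_space G : set {ptws G -> bool} :=
  [set f : {ptws G -> bool} | subgroup [set val g | g in [set g : G | f g]]].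

End Subgroups.
Arguments subgroup_space {gT} G.

Notation vertex d := (seq 'I_d).

Definition child d (v w : vertex d) : Prop := exists x, w = rcons v x.

Record treeAut d := TreeAut {
  aut :> vertex d -> vertex d;
  autV : vertex d -> vertex d;
  autK : cancel aut autV;
  autVK : cancel autV aut;
  aut_root : aut [::] = [::];
  aut_child : forall v w, child v w <-> child (aut v) (aut w)
}.

Section TreeAutGroup.
Variable d : nat.
Implicit Types (v w : vertex d) (g h : treeAut d).

Lemma treeAut_ext g h : aut g =1 aut h -> g = h.
Proof.
case: g h => [f fV fK fVK fr fc] [k kV kK kVK kr kc] /= /funext fk.
move: fK fVK fr fc; rewrite {}fk => fK fVK fr fc.
have fkV : fV = kV by apply/funext => v; rewrite -[v in LHS]kVK fK.
move: fK fVK; rewrite {}fkV => fK fVK.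
by congr TreeAut; exact: Prop_irrelevance.
Qed.

HB.instance Definition _ := gen_eqMixin (treeAut d).
HB.instance Definition _ := gen_choiceMixin (treeAut d).

Definition aut1 : treeAut d :=
  @TreeAut d id id (fun=> erefl) (fun=> erefl) erefl (fun _ _ => iff_refl _).

Fact autI_root g : autV g [::] = [::].
Proof. by rewrite -{1}(aut_root g) autK. Qed.

Fact autI_child g v w : child v w <-> child (autV g v) (autV g w).
Proof. by rewrite (aut_child g (autV g v)) !autVK. Qed.

Definition autI g : treeAut d :=
  TreeAut (autVK g) (autK g) (autI_root g) (autI_child g).

Fact autM_root g h : (aut g \o aut h) [::] = [::].
Proof. by rewrite /= !aut_root. Qed.

Fact autM_child g h v w :
  child v w <-> child ((aut g \o aut h) v) ((aut g \o aut h) w).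
Proof. by rewrite (aut_child h) (aut_child g). Qed.

Definition autM g h : treeAut d :=
  TreeAut (can_comp (autK g) (autK h)) (can_comp (autVK h) (autVK g))
          (autM_root g h) (@autM_child g h).

Lemma autMA : associative autM.
Proof. by move=> f g h; exact: treeAut_ext. Qed.

Lemma aut1M : left_id aut1 autM.
Proof. by move=> g; exact: treeAut_ext. Qed.

Lemma autM1 : right_id aut1 autM.
Proof. by move=> g; exact: treeAut_ext. Qed.

Lemma autVM : left_inverse aut1 autI autM.
Proof. by move=> g; apply: treeAut_ext => v /=; exact: autK. Qed.

Lemma autMV : right_inverse aut1 autI autM.
Proof. by move=> g; apply: treeAut_ext => v /=; exact: autVK. Qed.

(* Aut(T) acts on the left: (g * h) v = g (h v). *)
HB.instance Definition _ :=
  isGroup.Build (treeAut d) autMA aut1M autM1 autVM autMV.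

Lemma section_catE g v w : g (v ++ w) = g v ++ drop (size (g v)) (g (v ++ w)).
Proof.
elim/last_ind: w => [|w x IHw]; first by rewrite cats0 drop_size cats0.
have /(aut_child g) [y] : child (v ++ w) (v ++ rcons w x).
  by exists x; rewrite rcons_cat.
by rewrite IHw => ->; rewrite rcons_cat drop_size_cat.
Qed.

(* The only w' with g (v ++ w) = g v ++ w', see [sectionE]. *)
Definition section_fun v g w : vertex d := drop (size (g v)) (g (v ++ w)).

Definition section_inv v g w : vertex d := drop (size v) (autV g (g v ++ w)).

Fact section_funK v g : cancel (section_fun v g) (section_inv v g).
Proof. by move=> w; rewrite /section_inv -section_catE autK drop_size_cat. Qed.

Fact section_invK v g : cancel (section_inv v g) (section_fun v g).
Proof.
move=> w; rewrite /section_fun /section_inv.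
have := section_catE (autI g) (g v) w; rewrite /= autK => <-.
by rewrite autVK drop_size_cat.
Qed.

Fact section_root v g : section_fun v g [::] = [::].
Proof. by rewrite /section_fun cats0 drop_size. Qed.

Fact child_cat (u v w : vertex d) : child v w <-> child (u ++ v) (u ++ w).
Proof.
split=> -[x]; first by move=> ->; exists x; rewrite rcons_cat.
rewrite rcons_cat => /(congr1 (drop (size u))).
by rewrite !drop_size_cat// => ->; exists x.
Qed.

Fact section_child v g w1 w2 :
  child w1 w2 <-> child (section_fun v g w1) (section_fun v g w2).
Proof.
by rewrite (child_cat v) (aut_child g) (section_catE g v w1)
  (section_catE g v w2) -child_cat.
Qed.

Definition section v g : treeAut d :=
  TreeAut (section_funK v g) (section_invK v g) (section_root v g)
          (section_child v g).

Lemma sectionE g v w : g (v ++ w) = g v ++ section v g w.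
Proof. exact: section_catE. Qed.

End TreeAutGroup.

Section TreeGroups.
Variable d : nat.
Implicit Types (G H L : set (treeAut d)) (X : set (set (treeAut d))).
Local Open Scope group_scope.

Definition level (n : nat) : set (vertex d) := [set v | size v = n].

Definition Stab G (V : set (vertex d)) : set (treeAut d) :=
  [set g | G g /\ forall v, V v -> g v = v].

Definition congruence_subgroup_property G : Prop :=
  forall H, subgroup_of H G -> finite_index H G ->
  exists n, Stab G (level n) `<=` H.

Definition self_similar G : Prop := forall v, section v @` G `<=` G.

Definition super_strongly_self_replicating G : Prop :=
  forall n v, level n v -> section v @` Stab G (level n) = G.

Definition Rist G (v : vertex d) : set (treeAut d) :=
  [set g | G g /\ forall w, ~~ prefix v w -> g w = w].

Definition Rist_level G (n : nat) : set (treeAut d) :=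
  generated (\bigcup_(v in level n) Rist G v).

Definition branch G : Prop :=
  [/\ forall n v w, level n v -> level n w -> exists2 g, G g & g v = w,
      forall v, infinite_set (Rist G v) &
      forall n, finite_index (Rist_level G n) G].

Record inductive_class G X : Prop := InductiveClass {
  inductive_sub : forall H, X H -> subgroup_of H G;
  inductive_triv : X [set 1];
  inductive_full : X G;
  inductive_index : forall H L, subgroup_of H G -> subgroup_of L G ->
    H `<=` L -> finite_index H L -> X H -> X L;
  inductive_section : forall H, subgroup_of H (Stab G (level 1)) ->
    finitely_generated H -> (forall v, level 1 v -> X (section v @` H)) -> X H
}.

Definition subgroup_induction_property G : Prop :=
  forall X, inductive_class G X ->
  forall H, subgroup_of H G -> finitely_generated H -> X H.

End TreeGroups.

(* Main.v *)
Require Import Defs.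
From mathcomp Require Import all_boot.
From mathcomp Require Import mathcomp_extra boolp classical_sets functions.
From mathcomp Require Import cardinality topology.

(** A subgroup [K] of [G] is called large when, for some level [n], all the
   sections at level [n] of the level stabilizer of [K] have finite index in
   [G]. Large subgroups are closed under passing to overgroups. The perfect
   kernel of the space of subgroups turns out to be the set of the subgroups
   that are not large, and every large subgroup has finite rank, with no bound
   on these ranks; so the rank is omega ([has_cb_rank_omega]).

   Preliminaries. The class of the subgroups having a level where all sections
   are trivial or of finite index is inductive, so it contains the finitely
   generated subgroups of [G]. Applied to cyclic groups this gives that [G] is
   torsion ([torsion]), and then that it is just infinite ([just_infinite]).

   Large subgroups have finite rank. Let [L] contain a fixed large subgroup. By
   the congruence subgroup property there is [m] such that the sections at level
   [n] of [L] contain the stabilizer of level [m]. Filter the stabilizer in [L]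
   of level [n + m] by support, adding one vertex of that level at a time. Each
   factor embeds in [G] as a section, and for a suitable order of the vertices
   super strong self-replication makes that section normal in [G]
   ([supported_section_normal]): it is trivial or of finite index. Hence [L] is
   finitely generated. Moreover the number of nontrivial factors is bounded, can
   only grow with [L], and detects whether an overgroup of [L] has finite index
   ([nfactors_eq_virtually_in]). The commensurator of [L] has as many nontrivial
   factors as [L] ([nfactors_commensurator]), hence contains [L] with finite
   index; avoiding finitely many coset representatives therefore excludes every
   proper overgroup with the same number of factors ([controlled_isolated]), and
   each derivative removes one value of this number.

   The other subgroups have no isolated point. If [K] is not finitely generated
   it is a limit of finitely generated subgroups of it. If it is finitely
   generated and not large, some section of [K] at a level [n] is trivial, below
   a vertex [v], and [K] is the limit of the groups generated by [K] and by
   elements supported below the [K]-orbit of deeper and deeper vertices below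
   [v] ([trivial_section_limit]).

   The ranks are unbounded. Fix two vertices of level 1. Prescribing that the
   sections of an element at corresponding descendants of level [r] of these two
   vertices agree, for all these descendants, defines a large subgroup; the
   condition at each descendant can be relaxed independently to agreement on a
   large finite ball, so this subgroup survives [r] derivatives
   ([twins_cb_derivative]). *)

Set Implicit Arguments.
Unset Strict Implicit.
Unset Printing Implicit Defensive.
Local Open Scope classical_set_scope.

(** * Virtual containment and finite generation in abstract groups *)

Section Groups.
Context {gT : groupType}.
Implicit Types (G H K L N : set gT) (x y z g h : gT).
Local Open Scope group_scope.

Lemma subgroupP H : subgroup H <->
  [/\ H 1, forall x y, H x -> H y -> H (x * y) & forall x, H x -> H x^-1].
Proof.
split=> [gH|[H1 HM HV]].
  split; first by have [/set_mem] := gH.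
    by move=> x y Hx Hy; apply/set_mem/(group_closedM gH); apply/mem_set.
  by move=> x Hx; apply/set_mem/(group_closedV gH); apply/mem_set.
split; first exact/mem_set.
by move=> x y /set_mem Hx /set_mem Hy; apply/mem_set/HM => //; exact: HV.
Qed.

Lemma subgroup1 H : subgroup H -> H 1.
Proof. by move=> /subgroupP[]. Qed.

Lemma subgroupM H x y : subgroup H -> H x -> H y -> H (x * y).
Proof. by move=> /subgroupP[_ + _]; apply. Qed.

Lemma subgroupV H x : subgroup H -> H x -> H x^-1.
Proof. by move=> /subgroupP[_ _]; apply. Qed.

Lemma subgroupX H x n : subgroup H -> H x -> H (x ^+ n).
Proof.
move=> gH Hx; elim: n => [|n IHn]; first exact: subgroup1.
by rewrite expgS; exact: subgroupM.
Qed.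

Lemma subgroup_conj G x y : subgroup G -> G x -> G y -> G (x * y * x^-1).
Proof. by move=> gG Gx Gy; apply: subgroupM (subgroupM _ _ _) (subgroupV _ _). Qed.

Lemma subgroupI H K : subgroup H -> subgroup K -> subgroup (H `&` K).
Proof.
move=> gH gK; apply/subgroupP; split.
- by split; exact: subgroup1.
- by move=> x y [Hx Kx] [Hy Ky]; split; exact: subgroupM.
- by move=> x [Hx Kx]; split; exact: subgroupV.
Qed.

Lemma subgroup_set1 : subgroup [set 1 : gT].
Proof.
apply/subgroupP; split=> //= [x y -> ->|x ->]; by rewrite /= ?mulg1 ?invg1.
Qed.

Lemma subgroup_generated (S : set gT) : subgroup (generated S).
Proof.
apply/subgroupP; split=> [A [gA _]|x y Sx Sy A gSA|x Sx A gSA].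
- exact: subgroup1 gA.
- exact: subgroupM gSA.1 (Sx _ gSA) (Sy _ gSA).
- exact: subgroupV gSA.1 (Sx _ gSA).
Qed.

Lemma generatedW (S : set gT) : S `<=` generated S.
Proof. by move=> x Sx A [_]; apply. Qed.

Lemma generated_min (S : set gT) H : subgroup H -> S `<=` H -> generated S `<=` H.
Proof. by move=> gH SH x; apply. Qed.

Lemma finitely_generatedP H : subgroup H ->
  finitely_generated H <->
  exists2 s : seq gT, (forall x, x \in s -> H x) &
    forall K, subgroup K -> (forall x, x \in s -> K x) -> H `<=` K.
Proof.
move=> gH; split.
  case=> S /finite_seqP[s ->] ->; exists s => [x xs|K gK sK]; first exact: generatedW.
  exact: generated_min.
case=> s sH Hs; exists [set` s]; first exact: finite_seq.
apply/seteqP; split; first by apply: Hs; [exact: subgroup_generated|exact: generatedW].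
exact: generated_min.
Qed.

(** Finite index is expressed by a finite-valued invariant separating the left
   cosets of [H] met by [L]: unlike lists of representatives, such invariants
   restrict, combine and pull back without any choice. *)
Definition virtually_in L H : Prop := exists (I : finType) (c : gT -> I),
  forall x y, L x -> L y -> c x = c y -> H (x^-1 * y).

Lemma virtually_in_sub L L' H H' :
  L `<=` L' -> H' `<=` H -> virtually_in L' H' -> virtually_in L H.
Proof.
move=> LL HH [I [c cP]]; exists I, c => x y Lx Ly /cP.
by move=> /(_ (LL _ Lx) (LL _ Ly))/HH.
Qed.

Lemma virtually_in_refl L : subgroup L -> virtually_in L L.
Proof.
move=> gL; exists unit, (fun=> tt) => x y Lx Ly _.
by apply: subgroupM => //; exact: subgroupV.
Qed.

Lemma virtually_inI L H K :
  virtually_in L H -> virtually_in L K -> virtually_in L (H `&` K).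
Proof.
move=> [I [c cP]] [J [e eP]]; exists (I * J)%type, (fun x => (c x, e x)).
by move=> x y Lx Ly [cxy exy]; split; [exact: cP|exact: eP].
Qed.

Lemma virtually_in_selfI L H : subgroup L ->
  virtually_in L H -> virtually_in L (H `&` L).
Proof. by move=> gL LH; apply: virtually_inI => //; exact: virtually_in_refl. Qed.

Lemma virtually_in_subI L H K : subgroup K ->
  virtually_in L H -> virtually_in (L `&` K) (H `&` K).
Proof.
move=> gK LH; apply: virtually_inI; first exact: virtually_in_sub LH.
by apply: virtually_in_sub (virtually_in_refl gK).
Qed.

Lemma virtually_in_repr L H : virtually_in L H ->
  exists (I : finType) (c : gT -> I) (r : I -> gT),
    (forall x, L x -> L (r (c x)) /\ c (r (c x)) = c x) /\
    (forall x y, L x -> L y -> c x = c y -> H (x^-1 * y)).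
Proof.
move=> [I [c cP]]; exists I, c, (fun i => xget 1 [set x | L x /\ c x = i]).
by split=> // x Lx; case: xgetP => [y -> []//|/(_ x)[]].
Qed.

Lemma virtually_in_trans L K H :
  virtually_in L K -> virtually_in K H -> virtually_in L H.
Proof.
move=> /virtually_in_repr[I [c [r [rP cP]]]] [J [e eP]].
exists (I * J)%type, (fun x => (c x, e ((r (c x))^-1 * x))).
move=> x y Lx Ly [cxy]; rewrite -cxy => exy.
have [Lr cr] := rP _ Lx.
have := eP _ _ (cP _ _ Lr Lx cr) (cP _ _ Lr Ly (etrans cr cxy)) exy.
by rewrite invgM invgK mulgA mulgK.
Qed.

Lemma virtually_in_image (f : gT -> gT) L H :
  {in L &, {morph f : x y / x^-1 * y}} ->
  virtually_in L H -> virtually_in (f @` L) (f @` H).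
Proof.
move=> fM [I [c cP]].
pose p y := xget 1 [set x | L x /\ f x = y].
have pP x : L x -> L (p (f x)) /\ f (p (f x)) = f x.
  by move=> Lx; rewrite /p; case: xgetP => [y -> []//|/(_ x)[]].
exists I, (c \o p) => _ _ [x Lx <-] [y Ly <-] /= cxy.
have [Lpx <-] := pP _ Lx; have [Lpy <-] := pP _ Ly.
by exists ((p (f x))^-1 * p (f y)); [exact: cP|rewrite fM//; exact/mem_set].
Qed.

Lemma morph_divP (f : gT -> gT) L : subgroup L ->
  {in L &, {morph f : x y / x^-1 * y}} ->
  [/\ f 1 = 1, forall x, L x -> f x^-1 = (f x)^-1,
      forall x y, L x -> L y -> f (x * y) = f x * f y &
      forall x y, L x -> L y -> f (x^-1 * y) = (f x)^-1 * f y].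
Proof.
move=> gL fM; have L1 := subgroup1 gL.
have fMx x y : L x -> L y -> f (x^-1 * y) = (f x)^-1 * f y.
  by move=> Lx Ly; apply: fM; exact/mem_set.
have f1 : f 1 = 1 by rewrite -[in LHS](mulVg 1) fMx// mulVg.
have fV x : L x -> f x^-1 = (f x)^-1.
  by move=> Lx; rewrite -[x^-1]mulg1 fMx// f1 mulg1.
split=> // x y Lx Ly; have Lx' := subgroupV gL Lx.
by rewrite -[x in x * y]invgK fMx// fV// invgK.
Qed.

(** Virtual containment is inherited along an extension: control the image
   under [f] and the kernel of [f]. *)
Lemma virtually_in_extension (f : gT -> gT) L H :
  subgroup L -> subgroup H -> H `<=` L ->
  {in L &, {morph f : x y / x^-1 * y}} ->
  virtually_in (f @` L) (f @` H) ->
  virtually_in [set x | L x /\ f x = 1] [set x | H x /\ f x = 1] ->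
  virtually_in L H.
Proof.
move=> gL gH HL fM /virtually_in_repr[I [c [r [rP cP]]]] [J [e eP]].
have [f1 fV fMM _] := morph_divP gL fM.
pose q i := xget 1 [set x | L x /\ f x = r i].
have qP x : L x -> L (q (c (f x))) /\ f (q (c (f x))) = r (c (f x)).
  move=> Lx; rewrite /q; case: xgetP => [y -> []//|].
  by have [[y Ly yr] _] := rP _ (imageP f Lx) => /(_ y)[].
(* [a x] is an element of [H] that brings x back to its representative up to
   the kernel of [f]. *)
pose a x := xget 1 [set h | H h /\ f h = f ((q (c (f x)))^-1 * x)].
have aP x : L x -> H (a x) /\ f (a x) = f ((q (c (f x)))^-1 * x).
  move=> Lx; rewrite /a; case: xgetP => [y -> []//|].
  have [Lq qr] := qP _ Lx; have [Lr cr] := rP _ (imageP f Lx).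
  have [h Hh hE] := cP _ _ Lr (imageP f Lx) cr.
  move=> /(_ h) /=; case; split=> //.
  by rewrite hE fMM ?fV ?qr//; exact: subgroupV.
pose k x := (q (c (f x)))^-1 * x * (a x)^-1.
exists (I * J)%type, (fun x => (c (f x), e (k x))) => x y Lx Ly [cxy exy].
have kP z : L z -> L (k z) /\ f (k z) = 1.
  move=> Lz; have [Lq qr] := qP _ Lz; have [Ha aE] := aP _ Lz.
  have Lqz : L ((q (c (f z)))^-1 * z) by apply: subgroupM => //; exact: subgroupV.
  have La : L (a z) by exact: HL.
  split; first by apply: subgroupM => //; exact: subgroupV.
  by rewrite /k fMM//; [rewrite fV// aE mulgV|exact: subgroupV].
have [+ _] := eP _ _ (kP _ Lx) (kP _ Ly) exy.
have [Hax _] := aP _ Lx; have [Hay _] := aP _ Ly.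
rewrite /k cxy => Hxy.
have -> : x^-1 * y = (a x)^-1 * (((q (c (f y)))^-1 * x * (a x)^-1)^-1 *
    ((q (c (f y)))^-1 * y * (a y)^-1)) * a y.
  by rewrite !invgM !invgK !mulgA mulVg mul1g mulgK mulgVK.
apply: subgroupM => //; apply: subgroupM => //; exact: subgroupV.
Qed.

Lemma finite_indexP H L : subgroup H -> subgroup L ->
  finite_index H L <-> virtually_in L H.
Proof.
move=> gH gL; split.
  move=> /finite_seqP[s sE].
  exists 'I_(size s).+1, (fun x => inord (index (left_coset x H) s)) => x y Lx Ly.
  have ins z : L z -> left_coset z H \in s.
    by move=> Lz; have : [set` s] (left_coset z H) by rewrite -sE; exists z.
  move=> /(congr1 (@nat_of_ord _)); rewrite !inordK ?ltnS ?index_size// => /(congr1 (nth set0 s)).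
  rewrite !nth_index ?ins// => xy.
  have : left_coset y H y by exists 1; [exact: subgroup1|rewrite mulg1].
  by rewrite -xy => -[h Hh <-]; rewrite mulKg.
move=> /virtually_in_repr[I [c [r [rP cP]]]].
apply: (@sub_finite_set _ _ ((fun i => left_coset (r i) H) @` [set: I])); last first.
  exact/finite_image/finite_finset.
move=> _ [x Lx <-]; exists (c x) => //; have [Lr cr] := rP _ Lx.
have Hrx := cP _ _ Lr Lx cr.
apply/seteqP; split=> _ [h Hh <-].
  exists (((r (c x))^-1 * x)^-1 * h).
    by apply: subgroupM => //; exact: subgroupV.
  by rewrite invgM invgK !mulgA mulgV mul1g.
exists ((r (c x))^-1 * x * h); first exact: subgroupM.
by rewrite !mulgA mulgV mul1g.
Qed.

(** Schreier: if T is a transversal and A is the subgroup of [H] generated by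
   the elements of [H] in T^-1 S T, then T A is stable under left
   multiplication by [S], hence is everything. *)
Lemma finitely_generated_finite_index H L : subgroup H -> subgroup L ->
  H `<=` L -> finitely_generated L -> virtually_in L H -> finitely_generated H.
Proof.
move=> gH gL HL /(finitely_generatedP gL)[s sL Ls].
move=> /virtually_in_repr[I [c [r [rP cP]]]].
pose T := 1 :: [seq r i | i : I].
pose S := s ++ [seq x^-1 | x <- s].
pose U := [seq w * u | w <- [seq t^-1 * x | t <- T, x <- 1 :: S], u <- T].
have {}rP x : L x -> exists t, [/\ t \in T, L t & H (t^-1 * x)].
  move=> Lx; have [Lr cr] := rP _ Lx; exists (r (c x)).
  by split=> //; [rewrite inE map_f ?mem_enum ?orbT|exact: cP].
pose A := generated ([set` U] `&` H).
have gA : subgroup A by exact: subgroup_generated.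
have AH : A `<=` H by apply: generated_min => // ? [].
exists ([set` U] `&` H); first exact/finite_setIl/finite_seq.
apply/seteqP; split=> // h Hh.
have UA t x u : t \in T -> x \in 1 :: S -> u \in T ->
    H (t^-1 * x * u) -> A (t^-1 * x * u).
  move=> tT xS uT Hu; apply: generatedW; split=> //.
  rewrite /=; apply/allpairsP; exists (t^-1 * x, u); split=> //.
  by apply/allpairsP; exists (t, x).
(* left multiplications preserving T A form a subgroup containing [s] *)
pose TA := [set x | exists2 t, t \in T & L t /\ A (t^-1 * x)].
pose B := [set x | forall y, TA y -> TA (x * y) /\ TA (x^-1 * y)].
have SB x : x \in S -> forall y, TA y -> TA (x * y).
  move=> xS y [t tT [Lt Aty]].
  have Lx : L x.
    move: xS; rewrite mem_cat => /orP[/sL//|/mapP[z /sL Lz ->]]; exact: subgroupV.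
  have [u [uT Lu Hu]] := rP _ (subgroupM gL Lx Lt).
  exists u => //; split=> //.
  have -> : u^-1 * (x * y) = u^-1 * x * t * (t^-1 * y) by rewrite !mulgA mulgK.
  apply: (subgroupM gA) => //; apply: UA; rewrite ?inE ?xS ?tT ?orbT//.
  by rewrite -mulgA.
have gB : subgroup B.
  apply/subgroupP; split.
  - by move=> y; rewrite invg1 mul1g.
  - move=> x y Bx By z TAz; split.
      by rewrite -mulgA; exact: (Bx _ (By _ TAz).1).1.
    by rewrite invgM -mulgA; exact: (By _ (Bx _ TAz).2).2.
  - by move=> x Bx y /Bx[]; rewrite invgK.
have LB : L `<=` B.
  apply: Ls => // x xs y TAy; split; apply: SB => //; rewrite mem_cat ?xs//.
  by rewrite map_f ?orbT.
have TA1 : TA 1.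
  exists 1; first by rewrite inE eqxx.
  split; first exact: subgroup1.
  by rewrite invg1 mul1g; exact: subgroup1 gA.
have [t tT [Lt At]] := (LB _ (HL _ Hh) _ TA1).1.
move: At; rewrite mulg1 => At.
have -> : h = (t^-1 * 1 * 1)^-1 * (t^-1 * h) by rewrite !mulg1 invgK mulgA mulgV mul1g.
apply: (subgroupM gA) => //; apply: (subgroupV gA); apply: UA => //; rewrite ?inE ?eqxx//.
have -> : t^-1 * 1 * 1 = (t^-1 * h) * h^-1 by rewrite !mulg1 mulgK.
by apply: subgroupM; [|exact: AH|exact: subgroupV].
Qed.

Lemma finitely_generated_overgroup H L : subgroup H -> subgroup L ->
  H `<=` L -> finitely_generated H -> virtually_in L H -> finitely_generated L.
Proof.
move=> gH gL HL /(finitely_generatedP gH)[s sH Hs].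
move=> /virtually_in_repr[I [c [r [rP cP]]]].
apply/(finitely_generatedP gL).
exists (s ++ [seq x <- [seq r i | i : I] | `[< L x >]]).
  move=> x; rewrite mem_cat mem_filter => /orP[/sH/HL//|/andP[/asboolP]//].
move=> K gK sK x Lx; have [Lr cr] := rP _ Lx.
have -> : x = r (c x) * ((r (c x))^-1 * x) by rewrite mulgA mulgV mul1g.
apply: subgroupM => //.
  by apply: sK; rewrite mem_cat mem_filter asboolT// map_f ?orbT ?mem_enum.
by apply: (Hs K) => // [y ys|]; [apply: sK; rewrite mem_cat ys|exact: cP].
Qed.

(** Lift generators of the image and add generators of the kernel. *)
Lemma finitely_generated_extension (f : gT -> gT) L :
  subgroup L -> subgroup (f @` L) -> {in L &, {morph f : x y / x^-1 * y}} ->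
  finitely_generated (f @` L) ->
  finitely_generated [set x | L x /\ f x = 1] ->
  finitely_generated L.
Proof.
move=> gL gfL fM.
have [f1 fV fMM fMx] := morph_divP gL fM.
have gK : subgroup [set x | L x /\ f x = 1].
  apply/subgroupP; split=> [|x y [Lx fx] [Ly fy]|x [Lx fx]] /=.
  - by split; first exact: subgroup1.
  - by split; [exact: subgroupM|rewrite fMM// fx fy mulg1].
  - by split; [exact: subgroupV|rewrite fV// fx invg1].
move=> /(finitely_generatedP gfL)[s sP fLs] /(finitely_generatedP gK)[t tK Kt].
pose p y := xget 1 [set x | L x /\ f x = y].
have pP y : y \in s -> L (p y) /\ f (p y) = y.
  by move=> /sP[x Lx xy]; rewrite /p; case: xgetP => [z -> []//|/(_ x)[]].
apply/(finitely_generatedP gL); exists (map p s ++ t).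
  by move=> x; rewrite mem_cat => /orP[/mapP[y /pP[Lp _] ->]//|/tK[]].
move=> M gM stM x Lx.
have : (f @` (M `&` L)) (f x).
  apply: (fLs (f @` (M `&` L))); last by exists x.
    apply/subgroupP; split.
    - by exists 1 => //; split; exact: subgroup1.
    - move=> _ _ [y [My Ly] <-] [z [Mz Lz] <-]; exists (y * z); last exact: fMM.
      by split; exact: subgroupM.
    - move=> _ [y [My Ly] <-]; exists y^-1; last exact: fV.
      by split; exact: subgroupV.
  move=> y ys; have [Lp py] := pP _ ys; exists (p y) => //; split=> //.
  by apply: stM; rewrite mem_cat map_f.
move=> [m [Mm Lm] fm].
have -> : x = m * (m^-1 * x) by rewrite mulgA mulgV mul1g.
apply: subgroupM => //; apply: (Kt M) => //.
  by move=> y yt; apply: stM; rewrite mem_cat yt orbT.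
split; first by apply: subgroupM => //; exact: subgroupV.
by rewrite fMx// fm mulVg.
Qed.

(** A finitely generated torsion group that is abelian modulo a normal
   subgroup [N] is finite modulo [N]: every element is a monomial in the
   generators with bounded exponents. *)
Lemma virtually_in_abelian_torsion G N L : subgroup G -> subgroup N ->
  (forall g x, G g -> N x -> N (g * x * g^-1)) ->
  subgroup L -> L `<=` G -> finitely_generated L ->
  (forall x, L x -> exists2 n, 0 < n & x ^+ n = 1) ->
  (forall x y, L x -> L y -> N (x * y * x^-1 * y^-1)) ->
  virtually_in L N.
Proof.
move=> gG gN nN gL LG /(finitely_generatedP gL)[s sL Ls] tors comm.
pose o x := xget 1%N [set n | 0 < n /\ x ^+ n = 1].
have oP x : L x -> 0 < o x /\ x ^+ o x = 1.
  move=> Lx; rewrite /o; case: xgetP => [n -> []//|].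
  by have [n n0 xn] := tors _ Lx => /(_ n); case.
pose fix reps t :=
  if t is x :: t' then [seq x ^+ i * p | i <- iota 0 (o x), p <- reps t'] else [:: 1].
pose P t := [set x | L x /\ exists2 p, p \in reps t & L p /\ N (p^-1 * x)].
have Pmul t : (forall x, x \in t -> L x) ->
    forall x y, x \in t -> P t y -> P t (x * y).
  elim: t => [//|z t IHt] tL x y.
  have Lz : L z by apply: tL; rewrite inE eqxx.
  have {}IHt := IHt (fun u ut => tL u (@mem_behead _ (z :: t) u ut)).
  have [o0 oz] := oP _ Lz.
  move=> xzt [Ly [q /allpairsP[[i p] [/= iI pt ->]] [Lq Nq]]].
  have Lx := tL _ xzt; split; first exact: subgroupM.
  have Lzi : L (z ^+ i) by exact: subgroupX.
  have Lp : L p.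
    have -> : p = (z ^+ i)^-1 * (z ^+ i * p) by rewrite mulKg.
    by apply: subgroupM => //; exact: subgroupV.
  move: xzt; rewrite inE => /orP[/eqP xz|xt].
    exists (z ^+ (i.+1 %% o z) * p).
      by apply/allpairsP; exists ((i.+1 %% o z)%N, p); split=> //=; rewrite mem_iota ltn_mod.
    have -> : z ^+ (i.+1 %% o z) = z ^+ i.+1.
      rewrite [in RHS](divn_eq i.+1 (o z)) expgnDr mulnC expgnA oz.
      by rewrite expg1n mul1g.
    split; first by apply: subgroupM => //; exact: subgroupX.
    by move: Nq; rewrite xz expgS !invgM -!mulgA mulKg.
  have : P t (x * ((z ^+ i)^-1 * y)).
    apply: IHt => //; split.
      by apply: subgroupM => //; exact: subgroupV.
    by exists p => //; split=> //; move: Nq; rewrite invgM -!mulgA.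
  move=> [_ [r rt [Lr Nr]]]; exists (z ^+ i * r).
    by apply/allpairsP; exists (i, r); split.
  split; first exact: subgroupM.
  pose w := (z ^+ i)^-1 * y.
  have Lw : L w by apply: subgroupM => //; exact: subgroupV.
  (* moving x across a power of z costs an element of [N] *)
  have -> : (z ^+ i * r)^-1 * (x * y) =
      (r^-1 * (x * w)) * ((x * w)^-1 * ((z ^+ i)^-1 * x * z ^+ i * x^-1) * ((x * w)^-1)^-1).
    rewrite /w !invgM !invgK !mulgA; congr (_ * _).
    by rewrite !(mulgVK, mulgK).
  apply: subgroupM => //; apply: nN.
    by apply: LG; apply: (subgroupV gL); exact: (subgroupM gL).
  have := comm _ _ (subgroupV gL Lzi) Lx; by rewrite invgK.
pose B := [set x | L x /\ forall y, P s y -> P s (x * y)].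
have gB : subgroup B.
  have BM x y : B x -> B y -> B (x * y).
    move=> [Lx Bx] [Ly By]; split; first exact: subgroupM.
    by move=> z Pz; rewrite -mulgA; apply/Bx/By.
  have B1 : B 1 by split=> [|y]; [exact: subgroup1|rewrite mul1g].
  apply/subgroupP; split=> // x Bx; have [o0 ox] := oP _ Bx.1.
  have -> : x^-1 = x ^+ (o x).-1.
    by apply: (mulgI x); rewrite mulgV -expgS prednK.
  by elim: (_.-1) => [//|n IHn]; rewrite expgS; exact: BM.
have LB : L `<=` B.
  by apply: Ls => // x xs; split; [exact: sL|move=> y; exact: Pmul].
have P1 : P s 1.
  split; first exact: subgroup1.
  exists 1; last by rewrite invg1 mulg1; split; exact: subgroup1.
  have : forall x, x \in s -> L x by [].
  elim: (s) => [|x t IHt] tL; first by rewrite inE.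
  apply/allpairsP; exists (0%N, 1); split=> /=; last by rewrite mulg1.
    by rewrite mem_iota /= add0n; apply: (oP x _).1; apply: tL; rewrite inE eqxx.
  by apply: IHt => y yt; apply: tL; rewrite inE yt orbT.
pose m x := xget 1 [set p | p \in reps s /\ N (p^-1 * x)].
have mP x : L x -> m x \in reps s /\ N ((m x)^-1 * x).
  move=> Lx; rewrite /m; case: xgetP => [p -> []//|].
  have [_ /(_ _ P1)] := LB _ Lx; rewrite mulg1 => -[_ [p ps [_ Np]]] /(_ p).
  by case.
exists 'I_(size (reps s)).+1, (fun x => inord (index (m x) (reps s))) => x y Lx Ly.
have [mx Nx] := mP _ Lx; have [my Ny] := mP _ Ly.
move=> /(congr1 (@nat_of_ord _)); rewrite !inordK ?ltnS ?index_size//.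
move=> /(congr1 (nth 1 (reps s))); rewrite !nth_index// => mxy.
have -> : x^-1 * y = ((m x)^-1 * x)^-1 * ((m y)^-1 * y).
  by rewrite mxy invgM invgK !mulgA mulgK.
by apply: subgroupM => //; exact: subgroupV.
Qed.

(** The elements commuting with a given one modulo a normal subgroup form a
   subgroup; use this in each variable in turn. *)
Lemma commutators_generated G N (S : set gT) : subgroup G -> subgroup N ->
  (forall g x, G g -> N x -> N (g * x * g^-1)) -> S `<=` G ->
  (forall x y, S x -> S y -> N (x * y * x^-1 * y^-1)) ->
  forall x y, generated S x -> generated S y -> N (x * y * x^-1 * y^-1).
Proof.
move=> gG gN nN SG SN.
have flip x y : N (x * y * x^-1 * y^-1) -> N (y * x * y^-1 * x^-1).
  by move=> /(subgroupV gN); rewrite !invgM !invgK !mulgA.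
have gZ y : G y -> subgroup [set x | G x /\ N (x * y * x^-1 * y^-1)].
  move=> Gy; apply/subgroupP; split.
  - split; first exact: subgroup1.
    by rewrite mul1g invg1 mulg1 mulgV; exact: subgroup1.
  - move=> x z [Gx Nx] [Gz Nz]; split; first exact: subgroupM.
    have -> : x * z * y * (x * z)^-1 * y^-1 =
        x * (z * y * z^-1 * y^-1) * x^-1 * (x * y * x^-1 * y^-1).
      by rewrite invgM !mulgA !mulgVK.
    by apply: subgroupM => //; exact: nN.
  - move=> x [Gx Nx]; split; first exact: subgroupV.
    have := nN _ _ (subgroupV gG Gx) (flip _ _ Nx).
    by rewrite !invgK !mulgA mulgVK.
have SgG := generated_min gG SG.
have gSN x y : S x -> generated S y -> N (x * y * x^-1 * y^-1).
  move=> Sx gSy; apply: flip.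
  have : generated S `<=` [set y | G y /\ N (y * x * y^-1 * x^-1)].
    apply: generated_min; first exact/gZ/SG.
    by move=> z Sz; split; [exact: SG|exact: SN].
  by move=> /(_ _ gSy)[].
move=> x y gSx gSy.
have : generated S `<=` [set x | G x /\ N (x * y * x^-1 * y^-1)].
  apply: generated_min; first exact/gZ/SgG.
  by move=> z Sz; split; [exact: SG|exact: gSN].
by move=> /(_ _ gSx)[].
Qed.

Lemma virtually_in1_finite L : virtually_in L [set 1] -> finite_set L.
Proof.
move=> /virtually_in_repr[I [c [r [rP cP]]]].
apply: (@sub_finite_set _ _ (r @` [set: I])); last exact/finite_image/finite_finset.
move=> x Lx; exists (c x) => //; have [Lr cr] := rP _ Lx.
have /= /(congr1 (mul (r (c x)))) := cP _ _ Lr Lx cr.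
by rewrite mulg1 mulgA mulgV mul1g.
Qed.

Lemma infinite_virtually_in L H : subgroup L -> infinite_set L ->
  virtually_in L H -> exists x, [/\ L x, H x & x <> 1].
Proof.
move=> gL infL LH; apply: contrapT => /forallNP noH; apply: infL.
apply/virtually_in1_finite/(virtually_in_sub _ _ (virtually_in_selfI gL LH)) => //.
by move=> x [Hx Lx] /=; apply: contrapT => x1; apply: (noH x).
Qed.

Lemma virtually_in_power L H x : subgroup L -> L x -> virtually_in L H ->
  exists2 n, 0 < n & H (x ^+ n).
Proof.
move=> gL Lx [I [c cP]].
pose f (i : 'I_#|I|.+1) := c (x ^+ i).
have /injectivePn[i [j ij fij]] : ~~ injectiveb f.
  by apply/negP => /injectiveP/leq_card; rewrite card_ord ltnn.
wlog lt_ij : i j ij fij / i < j => [wl|].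
  have [|lt_ji|/val_inj ijE] := ltngtP i j; first exact: wl.
    by apply: (wl j i); rewrite // eq_sym.
  by rewrite ijE eqxx in ij.
exists (j - i); first by rewrite subn_gt0.
have -> : x ^+ (j - i) = (x ^+ i)^-1 * x ^+ j.
  by rewrite -[in x ^+ j](subnKC (ltnW lt_ij)) expgnDr mulKg.
by apply: cP => //; exact: subgroupX.
Qed.

End Groups.

(** * Cantor-Bendixson ranks equal to omega *)

Local Notation fin n := (iter n OSucc OZero).

Section CantorBendixsonOmega.
Context {X : topologicalType}.
Implicit Types (A B P Y : set X) (a b : Ord).

Lemma derivedS A B : A `<=` B -> derived A `<=` derived B.
Proof.
move=> AB x [Ax niso]; split; first exact: AB.
move=> [_ [V Vx VB]]; apply: niso; split; first exact/mem_set.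
exists V => //; apply/seteqP; split=> [y [Vy /AB By]|_ ->].
  by rewrite -VB.
by split=> //; exact: nbhs_singleton.
Qed.

Lemma cb_derivative_sub Y a : cb_derivative Y a `<=` Y.
Proof. by elim: a => [//|a IHa x [/IHa]//|I f _ x []]. Qed.

Lemma cb_derivative_le Y m n : m <= n ->
  cb_derivative Y (fin n) `<=` cb_derivative Y (fin m).
Proof.
move=> /subnKC <-; elim: (n - m) => [|k IHk]; first by rewrite addn0.
by rewrite addnS => x [/IHk].
Qed.

Lemma dense_in_itself_cb_derivative P Y a :
  P `<=` Y -> P `<=` derived P -> P `<=` cb_derivative Y a.
Proof.
move=> PY Pder; elim: a => [//|a IHa|I f IHf] x Px /=.
  exact/(derivedS IHa)/Pder.
by split; [exact: PY|move=> i _; exact: IHf].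
Qed.

Lemma cb_derivative_stable Y n : cb_derivative Y (fin n) = cb_derivative Y (fin n.+1) ->
  forall k, cb_derivative Y (fin (n + k)) = cb_derivative Y (fin n).
Proof.
move=> E; elim=> [|k IHk]; first by rewrite addn0.
by rewrite addnS [LHS]/= IHk {2}E.
Qed.

(** Trees below omega are equivalent to natural numbers, as far as derivatives
   are concerned; this replaces the linear order of ordinals. *)
Lemma omega_le_or_finite Y a : (forall n, ole (fin n) a) \/
  exists2 n, cb_derivative Y a = cb_derivative Y (fin n) &
             forall k, k <= n -> ole (fin k) a.
Proof.
elim: a => [|a [IHa|[n En IHn]]|I f IHf].
- by right; exists 0 => // k; rewrite leqn0 => /eqP ->.
- by left=> -[|n] //=; exact: IHa.
- by right; exists n.+1 => [/=|[|k] //=]; [rewrite En|exact: IHn].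
have sup k i : ole (fin k) (f i) -> ole (fin k) (OSup f).
  by case: k => [//|k] /= ?; exists i.
have [[i fi]|/forallNP nf] := EM (exists i, forall n, ole (fin n) (f i)).
  by left=> n; exact: sup (fi n).
have {nf}/choice[r rP] i : exists n, cb_derivative Y (f i) = cb_derivative Y (fin n) /\
    forall k, k <= n -> ole (fin k) (f i).
  by have [/nf//|[n En kn]] := IHf i; exists n.
have [unb|/existsNP[N bN]] := EM (forall N, exists i, N < r i).
  by left=> n; have [i /ltnW ni] := unb n; apply: sup; exact: (rP i).2.
have {bN}rN i : r i <= N.
  by rewrite leqNgt; apply/negP => Ni; apply: bN; exists i.
have [[i0 _]|nI] := EM (exists i : I, True); last first.
  right; exists 0 => [|k]; last by rewrite leqn0 => /eqP ->.
  by rewrite /=; apply/seteqP; split=> [x []//|x Yx]; split=> // i; case: nI; exists i.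
have [i imax] : exists i, forall j, r j <= r i.
  have ex : exists n, `[< exists i, r i = n >] by exists (r i0); apply/asboolP; exists i0.
  have ub n : `[< exists i, r i = n >] -> n <= N by move=> /asboolP[i <-].
  have [_ /asboolP[i <-] imax] := ex_maxnP ex ub.
  by exists i => j; apply: imax; apply/asboolP; exists j.
right; exists (r i) => [/=|k ki]; last exact: sup ((rP i).2 _ ki).
apply/seteqP; split=> x.
  by move=> [_ /(_ i Logic.I)]; rewrite (rP i).1.
move=> xi; split; first exact: cb_derivative_sub xi.
by move=> j _; rewrite (rP j).1; exact: (cb_derivative_le (imax j)).
Qed.

(** [P] survives all derivatives since it is dense in itself, and is all that is
   left after omega of them. *)
Lemma has_cb_rank_omega P Y : P `<=` Y -> P `<=` derived P ->
  (forall x, Y x -> ~ P x -> exists n, ~ cb_derivative Y (fin n) x) ->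
  (forall n, exists2 x, ~ P x & cb_derivative Y (fin n) x) ->
  has_cb_rank Y omega.
Proof.
move=> PY Pder out unb.
have YP : cb_derivative Y omega = P.
  apply/seteqP; split=> [x [Yx xn]|]; last exact: dense_in_itself_cb_derivative.
  apply: contrapT => /(out x Yx)[n]; apply; exact: (xn n).
split.
  change (cb_derivative Y omega = derived (cb_derivative Y omega)).
  by rewrite YP; apply/seteqP; split=> // x [].
move=> a; have [//|[n En _]] := omega_le_or_finite Y a.
rewrite [in X in _ = X -> _]/= En => /cb_derivative_stable stab.
have [x nPx xn] := unb n.
have [k []] := out x (cb_derivative_sub xn) nPx.
by apply: (cb_derivative_le (leq_addl n k)); rewrite stab.
Qed.

End CantorBendixsonOmega.

(** * The space of subgroups *)

Section SubgroupSpace.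
Context {gT : groupType} (G : set gT).
Implicit Types (K L : set gT) (F : seq gT) (f h : {ptws G -> bool}).

Definition carrier f : set gT := [set val g | g in [set g : G | f g]].

Definition indicator K : {ptws G -> bool} := fun g => `[< K (val g) >].

Lemma carrier_sub f : carrier f `<=` G.
Proof. by move=> _ [g _ <-]; exact: set_valP. Qed.

Lemma indicatorK K : K `<=` G -> carrier (indicator K) = K.
Proof.
move=> KG; apply/seteqP; split=> [_ [g /asboolP Kg <-]//|x Kx].
have Gx : x \in G by apply/mem_set/KG.
by exists (SigSub Gx) => //; apply/asboolP.
Qed.

Lemma carrierK f : indicator (carrier f) = f.
Proof.
apply/funext => g; apply/asboolP/idP => [[h fh /val_inj <-]//|fg].
by exists g.
Qed.

Lemma subgroup_space_indicator K : subgroup_of K G -> subgroup_space G (indicator K).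
Proof. by move=> [gK KG]; rewrite /subgroup_space/= -/(carrier _) indicatorK. Qed.

Definition agree_on F f h : Prop := forall g : G, val g \in F -> h g = f g.

Lemma nbhs_agree_on F f : nbhs f (agree_on F f).
Proof.
elim: F => [|x F IHF]; first by apply: filterS filterT => h _ g.
have [Gx|nGx] := EM (G x); last first.
  apply: filterS IHF => h hF g; rewrite inE => /orP[/eqP gx|/hF//].
  by case: nGx; rewrite -gx; exact: set_valP.
pose g0 : G := SigSub (mem_set Gx).
have : nbhs f [set h | h g0 = f g0].
  have := @proj_continuous G (fun=> bool) g0 f [set f g0].
  by apply; exact: discrete_set1.
apply: filterS2 IHF => h hF h0 g; rewrite inE => /orP[/eqP gx|/hF//].
by have -> : g = g0 by apply: val_inj.
Qed.

(** The sets containing some cylinder at [f] form a filter that converges to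
   [f] pointwise, so it is finer than the neighborhood filter. *)
Lemma nbhs_agree_onP f (U : set {ptws G -> bool}) : nbhs f U ->
  exists F, agree_on F f `<=` U.
Proof.
pose Phi : set_system {ptws G -> bool} := [set V | exists F, agree_on F f `<=` V].
have FPhi : Filter Phi.
  split; first by exists [::].
    move=> A B [F FA] [F' FB]; exists (F ++ F') => h hF; split.
      by apply: FA => g gF; apply: hF; rewrite mem_cat gF.
    by apply: FB => g gF; apply: hF; rewrite mem_cat gF orbT.
  by move=> A B AB [F FA]; exists F => h /FA/AB.
suff : Phi --> f by apply.
apply/cvg_sup => g; apply/cvg_image.
  apply/seteqP; split=> // b _; by exists (fun=> b).
move=> A Ab; exists ([set h | A (h g)]); last first.
  apply/seteqP; split=> [_ [h Ah <-]//|b Ab']; by exists (fun=> b).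
exists [:: val g] => h /(_ g); rewrite inE eqxx => /(_ isT) /= ->.
exact: nbhs_singleton Ab.
Qed.

Lemma derived_limit (Z : set {ptws G -> bool}) K : K `<=` G -> Z (indicator K) ->
  (forall F, exists L, [/\ L `<=` G, Z (indicator L), L <> K &
                           forall g, g \in F -> G g -> (L g <-> K g)]) ->
  derived Z (indicator K).
Proof.
move=> KG ZK limK; split=> // -[_ [V /nbhs_agree_onP[F FV] VZ]].
have [L [LG ZL LK LF]] := limK F.
have : (V `&` Z) (indicator L).
  split=> //; apply: FV => g gF; apply/asboolP/asboolP => /LF; apply=> //;
    exact: set_valP.
by rewrite VZ /= => E; apply: LK; rewrite -(indicatorK LG) E indicatorK.
Qed.

Lemma not_derived (Z : set {ptws G -> bool}) K (P Q : seq gT) :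
  (forall g, g \in P -> K g) -> (forall g, g \in Q -> G g /\ ~ K g) -> K `<=` G ->
  Z `<=` subgroup_space G ->
  (forall L, subgroup_of L G -> Z (indicator L) -> (forall g, g \in P -> L g) ->
             (forall g, g \in Q -> ~ L g) -> L = K) ->
  ~ derived Z (indicator K).
Proof.
move=> PK QK KG ZY iso [ZK]; apply; split; first exact/mem_set.
exists (agree_on (P ++ Q) (indicator K)); first exact: nbhs_agree_on.
apply/seteqP; split=> [h [hF Zh] /=|_ -> //].
rewrite -(carrierK h); congr indicator.
have hE g : G g -> g \in P ++ Q -> (carrier h g <-> K g).
  move=> Gg gF; have := hF (SigSub (mem_set Gg)) gF.
  rewrite -{1}(carrierK h) /indicator /= => E.
  by split=> /asboolP H; apply/asboolP; [rewrite -E|rewrite E].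
apply: iso.
- by split; [exact: (ZY _ Zh)|exact: carrier_sub].
- by rewrite carrierK.
- move=> g gP; apply/hE; [exact/KG/PK|by rewrite mem_cat gP|exact: PK].
- move=> g gQ; have [Gg nKg] := QK _ gQ.
  by move/hE => H; apply/nKg/H => //; rewrite mem_cat gQ orbT.
Qed.

End SubgroupSpace.
Arguments indicator {gT} G K _.

(** * Sections and level stabilizers of tree automorphisms *)

Section Tree.
Context {d : nat} (hd : 2 <= d).
Implicit Types (g h k a b : treeAut d) (u v w : vertex d) (G H K L : set (treeAut d)).
Local Open Scope group_scope.

Lemma size_aut g v : size (g v) = size v.
Proof.
elim/last_ind: v => [|v x IHv]; first by rewrite aut_root.
have /(aut_child g)[y ->] : child v (rcons v x) by exists x.
by rewrite !size_rcons IHv.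
Qed.

Lemma autgK g v : g^-1 (g v) = v. Proof. exact: autK. Qed.
Lemma autgVK g v : g (g^-1 v) = v. Proof. exact: autVK. Qed.

Lemma aut_inj g : injective g. Proof. exact: can_inj (autK g). Qed.

Lemma section_eq g v w u : g (v ++ w) = g v ++ u -> section v g w = u.
Proof.
rewrite sectionE => /(congr1 (drop (size (g v)))).
by rewrite !drop_size_cat.
Qed.

Lemma section1 v : section v 1 = 1.
Proof. by apply: treeAut_ext => u; exact: section_eq. Qed.

Lemma sectionM v g h : section v (g * h) = section (h v) g * section v h.
Proof.
apply: treeAut_ext => u; apply: section_eq => /=.
by change (g (h (v ++ u)) = g (h v) ++ section (h v) g (section v h u));
  rewrite !sectionE.
Qed.

Lemma section_cat v w g : section (v ++ w) g = section w (section v g).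
Proof.
apply: treeAut_ext => u; apply: section_eq.
by rewrite -catA !sectionE catA.
Qed.

Lemma sectionV v g : section (g v) g^-1 = (section v g)^-1.
Proof.
apply: (mulIg (section v g)); rewrite mulVg -sectionM mulVg; exact: section1.
Qed.

Lemma section_conj u g h : g u = u ->
  section (h u) (h * g * h^-1) = section u h * section u g * (section u h)^-1.
Proof.
move=> gu; rewrite sectionM sectionV autgK sectionM gu //.
Qed.

Definition fixes n g : Prop := forall v, size v = n -> g v = v.

Lemma fixes1 n : fixes n 1. Proof. by []. Qed.

Lemma fixesM n g h : fixes n g -> fixes n h -> fixes n (g * h).
Proof. by move=> gn hn v vn; change (g (h v) = v); rewrite hn ?gn. Qed.

Lemma fixesV n g : fixes n g -> fixes n g^-1.
Proof. by move=> gn v vn; apply: (@aut_inj g); rewrite autgVK gn. Qed.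

Lemma fixes_conj n g h : fixes n g -> fixes n (h * g * h^-1).
Proof.
move=> gn v vn; change (h (g (h^-1 v)) = v).
by rewrite gn ?autgVK// size_aut.
Qed.

Lemma fixes_le m n g : m <= n -> fixes n g -> fixes m g.
Proof.
move=> mn gn v vm; pose x : 'I_d := Ordinal (ltnW hd).
have := gn (v ++ nseq (n - m) x).
rewrite size_cat size_nseq vm subnKC// sectionE => /(_ erefl).
by move=> /(congr1 (take (size (g v)))); rewrite take_size_cat// size_aut take_size_cat.
Qed.

Lemma fixes_section m n g v : size v = m -> fixes (m + n) g -> fixes n (section v g).
Proof.
move=> vm gmn w wn; apply: section_eq.
by rewrite (fixes_le (leq_addr n m) gmn vm) gmn// size_cat vm wn.
Qed.

Lemma fixes_eq1 g : (forall n, fixes n g) -> g = 1.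
Proof. by move=> gn; apply: treeAut_ext => v; exact: gn. Qed.

Lemma fixes_sections_eq1 n g : fixes n g ->
  (forall v, size v = n -> section v g = 1) -> g = 1.
Proof.
move=> gn sg; apply: fixes_eq1 => m.
have [/fixes_le|/ltnW nm] := leqP m n; first exact.
move=> v vm; rewrite -(cat_take_drop n v) sectionE.
have sn : size (take n v) = n by rewrite size_takel// vm.
by rewrite sg// gn.
Qed.

Lemma neq1_moves g : g <> 1 -> exists v, g v <> v.
Proof.
move=> g1; apply: contrapT => /forallNP gv; apply: g1.
by apply: treeAut_ext => v; apply: contrapT; exact: gv.
Qed.

Lemma section_fixed_div n g h v : size v = n -> fixes n g -> fixes n h ->
  section v (g^-1 * h) = (section v g)^-1 * section v h.
Proof.
move=> vn gn hn; rewrite sectionM hn// -[in section v g^-1](gn v vn).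
by rewrite sectionV.
Qed.

Lemma section_fixedM n g h v : size v = n -> fixes n h ->
  section v (g * h) = section v g * section v h.
Proof. by move=> vn hn; rewrite sectionM hn. Qed.

Lemma section_fixedV n g v : size v = n -> fixes n g ->
  section v g^-1 = (section v g)^-1.
Proof. by move=> vn gn; rewrite -sectionV gn. Qed.

Lemma section_morph n v L : size v = n -> L `<=` fixes n ->
  {in L &, {morph section v : x y / x^-1 * y}}.
Proof.
move=> vn Ln x y /set_mem/Ln xn /set_mem/Ln yn; exact: section_fixed_div xn yn.
Qed.

Lemma subgroup_section n v L : size v = n -> subgroup L -> L `<=` fixes n ->
  subgroup (section v @` L).
Proof.
move=> vn gL Ln; apply/subgroupP; split.
- by exists 1; [exact: subgroup1|exact: section1].
- move=> _ _ [x Lx <-] [y Ly <-]; exists (x * y); first exact: subgroupM.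
  by rewrite (section_fixedM _ vn)//; exact: Ln.
- move=> _ [x Lx <-]; exists x^-1; first exact: subgroupV.
  by rewrite (section_fixedV vn)//; exact: Ln.
Qed.

Lemma Stab_fixes G n : Stab G (level n) `<=` fixes n.
Proof. by move=> g []. Qed.

Lemma subgroup_fixes n : subgroup (fixes n).
Proof.
apply/subgroupP; split; [exact: fixes1|move=> x y|move=> x].
  exact: fixesM.
exact: fixesV.
Qed.

Lemma subgroup_Stab G n : subgroup G -> subgroup (Stab G (level n)).
Proof. by move=> gG; apply: subgroupI => //; exact: subgroup_fixes. Qed.

Lemma Stab_sub G n : Stab G (level n) `<=` G.
Proof. by move=> g []. Qed.

Lemma StabS G H n : H `<=` G -> Stab H (level n) `<=` Stab G (level n).
Proof. by move=> HG g [/HG]. Qed.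

Lemma Stab_le G m n : m <= n -> Stab G (level n) `<=` Stab G (level m).
Proof. by move=> mn g [Gg gn]; split=> //; exact: fixes_le mn gn. Qed.

Lemma virtually_in_fixes G n : virtually_in G (fixes n).
Proof.
pose t0 g (t : n.-tuple 'I_d) : n.-tuple 'I_d :=
  Tuple (introT eqP (etrans (size_aut g t) (size_tuple t))).
exists {ffun n.-tuple 'I_d -> n.-tuple 'I_d}, (fun g => [ffun t => t0 g t]).
move=> g h _ _ /ffunP gh v vn; apply: (@aut_inj g); change (g (g^-1 (h v)) = g v).
rewrite autgVK; have := gh (Tuple (introT eqP vn)).
by rewrite !ffunE => /(congr1 val).
Qed.

Lemma virtually_in_Stab G n : subgroup G -> virtually_in G (Stab G (level n)).
Proof.
move=> gG; apply: virtually_inI; first exact: virtually_in_refl.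
exact: virtually_in_fixes.
Qed.

(** * Rigid stabilizers *)

Lemma prefix_cat_eq v w u : size v = size w -> prefix v (w ++ u) -> v = w.
Proof.
move=> vw /prefixP[z /(congr1 (take (size v)))].
by rewrite vw take_size_cat// -vw take_size_cat.
Qed.

Lemma Rist_fixes G v g : Rist G v g -> fixes (size v) g.
Proof.
move=> [_ gv].
have gN w : size w = size v -> w <> v -> g w = w.
  move=> wv nwv; apply: gv; apply/negP; rewrite -[w]cats0 => /prefix_cat_eq vw.
  by apply: nwv; rewrite vw.
move=> w wv; have [wE|nwv] := EM (w = v); last exact: gN.
rewrite wE; have [//|nv] := EM (g v = v).
by apply: (@aut_inj g); apply: gN => //; exact: size_aut.
Qed.

Lemma Rist_section G v g w : Rist G v g -> size w = size v -> w <> v ->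
  section w g = 1.
Proof.
move=> Rg wv nwv; have gw := Rist_fixes Rg wv.
apply: treeAut_ext => u; apply: section_eq; rewrite gw; apply: Rg.2.
by apply/negP => /prefix_cat_eq; rewrite wv => /(_ erefl)/esym.
Qed.

Lemma RistP G v g : G g -> fixes (size v) g ->
  (forall w, size w = size v -> w <> v -> section w g = 1) -> Rist G v g.
Proof.
move=> Gg gv sg; split=> // w vw.
have [/fixes_le|/ltnW vlew] := leqP (size w) (size v); first exact.
have sw : size (take (size v) w) = size v by rewrite size_takel.
rewrite -(cat_take_drop (size v) w) sectionE gv// sg//.
by move=> vE; move: vw; rewrite prefixE vE eqxx.
Qed.

Lemma subgroup_Rist G v : subgroup G -> subgroup (Rist G v).
Proof.
move=> gG; apply/subgroupP; split.
- by split; first exact: subgroup1.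
- move=> x y [Gx xv] [Gy yv]; split; first exact: subgroupM.
  by move=> w wv; change (x (y w) = w); rewrite yv ?xv.
- move=> x [Gx xv]; split; first exact: subgroupV.
  by move=> w wv; apply: (@aut_inj x); rewrite autgVK xv.
Qed.

Lemma Rist_conj G v g h : subgroup G -> G h -> Rist G v g ->
  Rist G (h v) (h * g * h^-1).
Proof.
move=> gG Gh Rg; have gv := Rist_fixes Rg; apply: RistP.
- by apply: subgroup_conj => //; case: Rg.
- by rewrite size_aut; exact: fixes_conj.
- move=> w; rewrite -(autgVK h w) !size_aut => wv nw.
  rewrite section_conj; last by apply: gv; rewrite size_aut.
  rewrite (Rist_section Rg) ?mulg1 ?mulgV ?size_aut//.
  by move=> E; apply: nw; rewrite E.
Qed.

Lemma RistI G v w g : size v = size w -> v <> w ->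
  Rist G v g -> Rist G w g -> g = 1.
Proof.
move=> vw nvw Rv Rw; apply: (fixes_sections_eq1 (Rist_fixes Rv)) => u uv.
have [uE|nuv] := EM (u = v); last exact: Rist_section Rv _ _.
by apply: (Rist_section Rw); rewrite uE.
Qed.

Lemma Rist_commute G v w g h : size v = size w -> v <> w ->
  Rist G v g -> Rist G w h -> g * h = h * g.
Proof.
move=> vw nvw Rg Rh; have gv := Rist_fixes Rg; have := Rist_fixes Rh.
rewrite -vw => hv; apply: (mulgI (h * g)^-1); rewrite mulVg.
apply: (fixes_sections_eq1 (n := size v)).
  by apply: fixesM; [apply: fixesV|]; exact: fixesM.
move=> u uv; rewrite (section_fixed_div uv); [|exact: fixesM..].
rewrite !(section_fixedM _ uv)//; have [uE|nuv] := EM (u = v).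
  by rewrite (Rist_section Rh) ?mul1g ?mulg1 ?mulVg// uE.
by rewrite (Rist_section Rg)// mulg1 mul1g mulVg.
Qed.

End Tree.

(** * Consequences of subgroup induction *)

Section Branch.
Context {d : nat} (hd : 2 <= d) (G : set (treeAut d)).
Hypotheses (gG : subgroup G) (fgG : finitely_generated G) (ssG : self_similar G)
  (srG : super_strongly_self_replicating G) (brG : branch G).
Implicit Types (g h k a b : treeAut d) (u v w : vertex d) (H K L : set (treeAut d)).
Local Open Scope group_scope.

Lemma level_bound (P : vertex d -> nat -> Prop) n :
  (forall v m m', m <= m' -> P v m -> P v m') ->
  (forall v, size v = n -> exists m, P v m) ->
  exists m, forall v, size v = n -> P v m.
Proof.
move=> Pmon Pex.
have [f fP] := choice (fun t : n.-tuple 'I_d => Pex t (size_tuple t)).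
exists (\max_t f t) => v vn; pose t := Tuple (introT eqP vn).
exact: Pmon (leq_bigmax t) (fP t).
Qed.

Lemma section_in g v : G g -> G (section v g).
Proof. by move=> Gg; apply: (ssG (v := v)); exists g. Qed.

Lemma section_image_sub L v : L `<=` G -> section v @` L `<=` G.
Proof. by move=> LG _ [g Lg <-]; apply/section_in/LG. Qed.

Lemma level_transitive v w : size v = size w -> exists2 g, G g & g v = w.
Proof. by move=> vw; have [+ _ _] := brG; apply; [|exact: esym vw]. Qed.

Lemma Rist_infinite v : infinite_set (Rist G v).
Proof. by have [_ + _] := brG; apply. Qed.

Lemma Rist_meets A v : virtually_in G A -> exists a, [/\ Rist G v a, A a & a <> 1].
Proof.
move=> GA; apply: infinite_virtually_in; first exact: subgroup_Rist.
  exact: Rist_infinite.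
by apply: virtually_in_sub GA => // g [].
Qed.

Lemma not_virtually_in1 A : A `<=` [set 1] -> ~ virtually_in G A.
Proof. by move=> A1 /(@Rist_meets _ [::])[a [_ /A1]]. Qed.

(** If [c] moves [v] then it carries the rigid stabilizer of [v] to that of
   another vertex, so it cannot centralize an element of the former. *)
Lemma trivial_centralizer A c : virtually_in G A -> G c ->
  (forall a, A a -> c * a = a * c) -> c = 1.
Proof.
move=> GA Gc cA; apply: contrapT => /neq1_moves[v cv].
have [a [Ra Aa a1]] := Rist_meets v GA.
have := Rist_conj hd gG Gc Ra; rewrite cA// mulgK => Rca.
by apply: a1; apply: (RistI hd (size_aut c v) cv Rca Ra).
Qed.

(** Self-replication at level [n] turns a finite index subgroup of [Stab G (level n)]
   into a finite index subgroup of [G]. *)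
Lemma section_virtually_in A n v : size v = n -> virtually_in G A ->
  virtually_in G (section v @` (A `&` Stab G (level n))).
Proof.
move=> vn GA; rewrite -[X in virtually_in X _](srG vn).
apply: virtually_in_image; first exact: (section_morph vn (@Stab_fixes _ _ _)).
have := virtually_in_subI (subgroup_Stab n gG) GA.
by apply: virtually_in_sub => // g [].
Qed.

Lemma section_Stab_cat H n m p q : subgroup H -> H `<=` G ->
  size p = n -> size q = m ->
  virtually_in G (section p @` Stab H (level n)) ->
  virtually_in G (section (p ++ q) @` Stab H (level (n + m))).
Proof.
move=> gH HG pn qm GH.
have sub : Stab H (level (n + m)) `<=` Stab H (level n).
  by move=> g; apply: (Stab_le hd); exact: leq_addr.
have : virtually_in (section p @` Stab H (level n))
                    (section p @` Stab H (level (n + m))).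
  apply: virtually_in_image; first exact: (section_morph pn (@Stab_fixes _ _ _)).
  by apply: virtually_in_sub (virtually_in_Stab (n + m) gH) => // g [].
move=> /(virtually_in_trans GH)/(section_virtually_in qm).
apply: virtually_in_sub => // _ [_ [[g Hg <-] _] <-].
by exists g => //; rewrite section_cat.
Qed.

(** The structure that subgroup induction gives to finitely generated
   subgroups, for some level [n]. *)
Definition sections_trivial_or_large n H : Prop := forall v, size v = n ->
  section v @` Stab H (level n) `<=` [set 1] \/
  virtually_in G (section v @` Stab H (level n)).

Lemma sections_trivial_cat H n m p q :
  section p @` Stab H (level n) `<=` [set 1] ->
  section (p ++ q) @` Stab H (level (n + m)) `<=` [set 1].
Proof.
move=> H1 _ [g Hg <-] /=; rewrite section_cat (_ : section p g = 1) ?section1//.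
by apply: H1; exists g => //; exact: (Stab_le hd (leq_addr _ _) Hg).
Qed.

Lemma sections_trivial_or_large_le n m H : subgroup H -> H `<=` G -> n <= m ->
  sections_trivial_or_large n H -> sections_trivial_or_large m H.
Proof.
move=> gH HG nm Hn v; rewrite -(subnKC nm) => vm; rewrite -(cat_take_drop n v).
have vn : size (take n v) = n by rewrite size_takel// vm leq_addr.
have [?|?] := Hn _ vn; [left|right].
  exact: sections_trivial_cat.
by apply: section_Stab_cat => //; rewrite size_drop vm addKn.
Qed.

Lemma finite_subgroup_Stab (F : set (treeAut d)) : finite_set F ->
  exists m, forall f, F f -> fixes m f -> f = 1.
Proof.
move=> /finite_seqP[s ->].
elim: s => [|x s [m mP]]; first by exists 0%N.
have [x1|/neq1_moves[v xv]] := EM (x = 1).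
  exists m => f /=; rewrite inE => /orP[/eqP -> //|]; exact: mP.
exists (maxn m (size v)) => f /=; rewrite inE => /orP[/eqP ->|fs] ff.
  by have := fixes_le hd (leq_maxr _ _) ff => /(_ _ erefl).
by apply: mP => //; exact: (fixes_le hd (leq_maxl _ _) ff).
Qed.

(** A finite section, as appears in an overgroup of finite index, becomes
   trivial at a deeper level; this is why the level has to vary. *)
Lemma inductive_trivial_or_large :
  inductive_class G [set H | subgroup_of H G /\
                             exists n, sections_trivial_or_large n H].
Proof.
split.
- by move=> H [].
- split; first by split; [exact: subgroup_set1|move=> _ ->; exact: subgroup1].
  by exists 0%N => v _; left=> _ [g [-> _] <-] /=; exact: section1.
- split; first by split=> //.
  exists 0%N => v v0; right; rewrite (srG v0); exact: virtually_in_refl.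
- move=> H L [gH HG] [gL LG] HL /(finite_indexP gH gL) LH [_ [n Hn]].
  split=> //.
  have LHs v : size v = n ->
      virtually_in (section v @` Stab L (level n)) (section v @` Stab H (level n)).
    move=> vn; apply: virtually_in_image; first exact: (section_morph vn (@Stab_fixes _ _ _)).
    exact: virtually_in_subI (subgroup_fixes _) LH.
  have [m mP] : exists m, forall v, size v = n ->
      virtually_in G (section v @` Stab L (level n)) \/
      forall f, (section v @` Stab L (level n)) f -> fixes m f -> f = 1.
    apply: level_bound => [v m m' mm' [?|P]|v vn]; [by left|right=> f Lf fm'|].
      by apply: P => //; exact: (fixes_le hd mm' fm').
    have [H1|GH] := Hn v vn; last first.
      by exists 0%N; left; apply: virtually_in_trans GH _; apply: virtually_in_sub
        (virtually_in_refl (subgroup_section vn (subgroup_Stab n gL) (@Stab_fixes _ _ _))) => //;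
        apply/image_subset/StabS.
    have /finite_subgroup_Stab[m mP] : finite_set (section v @` Stab L (level n)).
      by apply: virtually_in1_finite; apply: virtually_in_sub (LHs v vn).
    by exists m; right.
  exists (n + m)%N => v vm; rewrite -(cat_take_drop n v).
  have vn : size (take n v) = n by rewrite size_takel// vm leq_addr.
  have qm : size (drop n v) = m by rewrite size_drop vm addKn.
  have [GL|L1] := mP _ vn; [by right; apply: section_Stab_cat|left].
  move=> _ [g Lg <-] /=; rewrite section_cat (_ : section (take n v) g = 1) ?section1//.
  apply: L1; last exact: (fixes_section hd vn Lg.2).
  by exists g => //; exact: (Stab_le hd (leq_addr _ _) Lg).
- move=> H [gH HG1] fgH Hs.
  have HG : H `<=` G by move=> h /HG1[].
  split=> //.
  have Hf : H `<=` fixes 1 by move=> h /HG1[].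
  have gHs v : size v = 1%N -> subgroup (section v @` H).
    by move=> v1; exact: subgroup_section v1 gH Hf.
  have [n nP] : exists n, forall v, size v = 1%N ->
      size v = 1%N -> sections_trivial_or_large n (section v @` H).
    apply: level_bound => [v m m' mm' vP v1|v v1].
      apply: sections_trivial_or_large_le mm' (vP v1) => //; first exact: gHs.
      exact: section_image_sub.
    by have [_ [n nP]] := Hs v v1; exists n.
  exists (1 + n)%N => v vm; rewrite -(cat_take_drop 1 v).
  have v1 : size (take 1 v) = 1%N by rewrite size_takel// vm.
  have qm : size (drop 1 v) = n by rewrite size_drop vm addKn.
  have sub : section (take 1 v) @` Stab H (level (1 + n)) `<=`
             Stab (section (take 1 v) @` H) (level n).
    move=> _ [g [Hg gn] <-]; split; first by exists g.
    exact: (fixes_section hd v1 gn).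
  have [P1|GP] := nP _ v1 v1 _ qm; [left|right].
    move=> _ [g Hg <-] /=; rewrite section_cat; apply: P1.
    by exists (section (take 1 v) g) => //; apply: sub; exists g.
  apply: (virtually_in_trans GP).
  rewrite (_ : section _ @` Stab H _ =
      section (drop 1 v) @` (section (take 1 v) @` Stab H (level (1 + n)))); last first.
    by rewrite image_comp; apply: eq_imagel => g _ /=; exact: section_cat.
  apply: virtually_in_image; first exact: (section_morph qm (@Stab_fixes _ _ _)).
  have : virtually_in (section (take 1 v) @` H)
      (section (take 1 v) @` Stab H (level (1 + n))).
    apply: virtually_in_image; first exact: section_morph v1 Hf.
    exact: virtually_in_Stab.
  by apply: virtually_in_sub => // g [].
Qed.

Hypothesis sipG : subgroup_induction_property G.

Lemma finitely_generated_trivial_or_large H : subgroup H -> H `<=` G ->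
  finitely_generated H -> exists n, sections_trivial_or_large n H.
Proof.
move=> gH HG fgH.
by have [_] := sipG inductive_trivial_or_large (conj gH HG) fgH.
Qed.

(** The sections of a cyclic group are abelian, hence never large since large
   subgroups have trivial centralizers. *)
Lemma torsion g : G g -> exists2 n, 0 < n & g ^+ n = 1.
Proof.
move=> Gg; pose H := generated [set g].
have gH : subgroup H by exact: subgroup_generated.
have HG : H `<=` G by apply: generated_min => // _ ->.
have Hab x y : H x -> H y -> x * y = y * x.
  have gC z : subgroup [set x | x * z = z * x].
    apply/subgroupP; split=> /=; first by rewrite mulg1 mul1g.
      by move=> s t sz tz; rewrite -mulgA tz mulgA sz mulgA.
    move=> s sz; apply: (mulgI s); rewrite mulgA mulgV mul1g mulgA sz mulgK //.
  have Hg z : H z -> z * g = g * z.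
    have Hsub : H `<=` [set y | y * g = g * y] by apply: generated_min => // _ ->.
    exact: Hsub.
  move=> Hx; have Hsub : H `<=` [set y | y * x = x * y].
    by apply: generated_min => // _ -> /=; rewrite Hg.
  by move=> /Hsub ->.
have [n Hn] : exists n, sections_trivial_or_large n H.
  by apply: finitely_generated_trivial_or_large => //; exists [set g].
have H1 v : size v = n -> section v @` Stab H (level n) `<=` [set 1].
  move=> vn; have [//|GH] := Hn v vn.
  move=> c Hc; apply: (trivial_centralizer GH).
    case: Hc => x [Hx _] <-; exact/section_in/HG.
  case: Hc => x [Hx xn] <- _ [y [Hy yn] <-].
  by rewrite -!(section_fixedM _ vn)// Hab.
have [e e0 ge] := virtually_in_power gH (generatedW erefl) (virtually_in_Stab n gH).
exists e => //; apply: (fixes_sections_eq1 hd ge.2) => v vn.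
by apply: (H1 v vn); exists (g ^+ e).
Qed.

(** If [g] in [N] moves [v] and [a], [b] are supported
   below [v], then [[a, g], b] = [a, b], so [N] contains the commutators of
   the rigid stabilizers of level [size v]; the group they generate is finitely
   generated, torsion and abelian modulo [N]. *)
Lemma just_infinite N : subgroup N -> N `<=` G ->
  (forall g x, G g -> N x -> N (g * x * g^-1)) ->
  ~ N `<=` [set 1] -> virtually_in G N.
Proof.
move=> gN NG nN /existsNP[g /not_implyP[Ng /neq1_moves[v gv]]].
have Nv a b : Rist G v a -> Rist G v b -> N (b * a * b^-1 * a^-1).
  move=> Ra Rb; have Gg := NG _ Ng.
  pose c := g * a^-1 * g^-1.
  have Rc : Rist G (g v) c.
    by apply: (Rist_conj hd) => //; apply: subgroupV => //; exact: subgroup_Rist.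
  have Nac : N (a * c).
    rewrite /c !mulgA; apply: subgroupM => //; last exact: subgroupV.
    by apply: nN => //; case: Ra.
  clearbody c; have : N (b * (a * c) * b^-1 * (a * c)^-1).
    by apply: subgroupM => //; [apply: nN => //; case: Rb|exact: subgroupV].
  have cb : c * b^-1 = b^-1 * c.
    apply: (Rist_commute hd (size_aut g v) gv Rc).
    by apply: subgroupV => //; exact: subgroup_Rist.
  by rewrite invgM -!mulgA (mulgA c) cb !mulgA mulgK.
have Nx x a b : size x = size v -> Rist G x a -> Rist G x b -> N (b * a * b^-1 * a^-1).
  move=> /level_transitive[h Gh hx] Ra Rb.
  have := Nv _ _ (_ : Rist G v (h * a * h^-1)) (_ : Rist G v (h * b * h^-1)).
  rewrite -hx => /(_ (Rist_conj hd gG Gh Ra) (Rist_conj hd gG Gh Rb)).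
  move=> /(nN _ _ (subgroupV gG Gh)).
  by rewrite !invgM !invgK !mulgA mulVg mul1g !mulgVK.
pose S := \bigcup_(w in level (size v)) Rist G w.
have SG : S `<=` G by move=> x [w _ []].
have SN a b : S a -> S b -> N (a * b * a^-1 * b^-1).
  move=> [x xn Ra] [y yn Rb]; have [xy|nxy] := EM (x = y).
    by apply: (Nx x); rewrite // xy.
  rewrite (Rist_commute hd _ nxy Ra Rb); last by rewrite xn.
  by rewrite mulgK mulgV; exact: subgroup1.
have [_ _ /(_ (size v)) RG] := brG.
have gR : subgroup (Rist_level G (size v)) by exact: subgroup_generated.
have RG' : Rist_level G (size v) `<=` G by exact: generated_min.
move: RG => /(finite_indexP gR gG) GR; apply: (virtually_in_trans GR).
apply: (virtually_in_abelian_torsion gG) => //.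
- exact: finitely_generated_finite_index gR gG RG' fgG GR.
- by move=> x /RG'/torsion.
- exact: commutators_generated gG gN nN SG SN.
Qed.

(** * Large subgroups *)

(** The subgroups that are large at some level are those of finite
   Cantor-Bendixson rank. *)
Definition large n L : Prop := forall v, size v = n ->
  virtually_in G (section v @` Stab L (level n)).

Lemma large_le n m L : subgroup L -> L `<=` G -> n <= m -> large n L -> large m L.
Proof.
move=> gL LG nm Ln v; rewrite -(subnKC nm) => vm; rewrite -(cat_take_drop n v).
have vn : size (take n v) = n by rewrite size_takel// vm leq_addr.
by apply: section_Stab_cat => //; [rewrite size_drop vm addKn|exact: Ln].
Qed.

Lemma largeS n L L' : L `<=` L' -> large n L -> large n L'.
Proof.
move=> LL Ln v vn; apply: virtually_in_sub (Ln v vn) => //.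
exact/image_subset/StabS.
Qed.

Hypothesis cspG : congruence_subgroup_property G.

(** A quantitative form of largeness, inherited with the same [n] and [m] by all
   overgroups. *)
Definition controlled n m L : Prop := [/\ subgroup L, L `<=` G &
  forall v, size v = n -> Stab G (level m) `<=` section v @` Stab L (level n)].

Lemma large_controlled n L : subgroup L -> L `<=` G -> large n L ->
  exists m, controlled n m L.
Proof.
move=> gL LG Ln.
have [m mP] : exists m, forall v, size v = n ->
    Stab G (level m) `<=` section v @` Stab L (level n).
  apply: level_bound => [v m m' mm' vP g /(Stab_le hd mm')|v vn]; first exact: vP.
  have gS : subgroup (section v @` Stab L (level n)).
    exact: (subgroup_section vn (subgroup_Stab n gL) (@Stab_fixes _ _ _)).
  apply: cspG; last exact/(finite_indexP gS gG)/Ln.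
  by split=> //; apply: section_image_sub => g [/LG].
by exists m; split.
Qed.

Lemma controlledS n m L L' : subgroup L' -> L' `<=` G -> L `<=` L' ->
  controlled n m L -> controlled n m L'.
Proof.
move=> gL' L'G LL [_ _ Lm]; split=> // v vn g /(Lm v vn)[h Lh <-].
by exists h => //; exact: StabS Lh.
Qed.

Lemma controlled_large n m L : controlled n m L -> large (n + m) L.
Proof.
move=> [gL LG Lm]; apply: large_le (leq_addr _ _) _ => // v vn.
exact: virtually_in_sub (Lm v vn) (virtually_in_Stab m gG).
Qed.

Section Filtration.
Variables n m : nat.
Implicit Types (s : seq (vertex d)) (x z : vertex d).

(** As [s] grows by one vertex [x] at a time, these subgroups filter
   [Stab L (level (n + m))], and [section x] embeds the corresponding factor
   in [G]. *)
Definition supported L s : set (treeAut d) := [set g | [/\ L g, fixes (n + m) g &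
  forall z, size z = n + m -> z \notin s -> section z g = 1]].

(** An enumeration of vertices of level [n + m] is admissible when a block
   (the vertices with a common ancestor of level [n]) is completed before
   the next one begins. Elements of [L] that fix level [n] and the block of the
   current vertex then permute the vertices already listed. *)
Fixpoint admissible s : Prop :=
  if s is x :: s' then
    [/\ admissible s', x \notin s', size x = n + m &
        forall z z', z \in s' -> take n z <> take n x ->
          size z' = n + m -> take n z' = take n z -> z' \in s']
  else True.

Definition words (k : nat) : seq (vertex d) := [seq val t | t : k.-tuple 'I_d].

Lemma mem_words (k : nat) w : (w \in words k) = (size w == k).
Proof.
apply/mapP/eqP => [[t _ ->]|wk]; first exact: size_tuple.
by exists (Tuple (introT eqP wk)) => //; rewrite mem_enum.
Qed.

Lemma uniq_words (k : nat) : uniq (words k).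
Proof. by rewrite map_inj_uniq ?enum_uniq//; exact: val_inj. Qed.

Lemma admissible_full : exists2 s, admissible s & forall z, size z = n + m -> z \in s.
Proof.
suff blocks V : uniq V -> (forall v, v \in V -> size v = n) ->
    exists2 s, admissible s &
      forall z, (z \in s) = (size z == n + m) && (take n z \in V).
  have [v|s sA sE] := blocks (words n) (uniq_words n).
    by rewrite mem_words => /eqP.
  exists s => // z zM; have nz : n <= size z by rewrite zM leq_addr.
  by rewrite sE zM eqxx mem_words size_takel ?eqxx.
elim: V => [|v V IHV]; first by exists [::] => // z; rewrite in_nil andbF.
move=> /= /andP[vV uV] Vn; have vn : size v = n by apply: Vn; rewrite inE eqxx.
have [|s sA sE] := IHV uV; first by move=> u uV'; apply: Vn; rewrite inE uV' orbT.
suff block W : uniq W -> (forall w, w \in W -> size w = m) ->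
    admissible ([seq v ++ w | w <- W] ++ s).
  exists ([seq v ++ w | w <- words m] ++ s).
    by apply: block; [exact: uniq_words|move=> w; rewrite mem_words => /eqP].
  move=> z; rewrite mem_cat sE inE.
  have [zM|nzM] /= := eqVneq (size z) (n + m)%N; last first.
    rewrite orbF; apply/negbTE/mapP => -[w]; rewrite mem_words => /eqP wm zE.
    by move: nzM; rewrite zE size_cat vn wm eqxx.
  congr (_ || _); apply/mapP/eqP => [[w _ ->]|<-]; first by rewrite take_size_cat.
  exists (drop n z); last by rewrite cat_take_drop.
  by rewrite mem_words size_drop zM addKn.
elim: W => [//|w W IHW] /= /andP[wW uW] Wm.
have wm : size w = m by apply: Wm; rewrite inE eqxx.
split.
- by apply: IHW => // u uW'; apply: Wm; rewrite inE uW' orbT.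
- rewrite mem_cat sE take_size_cat// (negbTE vV) andbF orbF.
  apply/mapP => -[u uW' /(congr1 (drop n))]; rewrite !drop_size_cat// => wu.
  by move: wW; rewrite wu uW'.
- by rewrite size_cat vn wm.
- move=> z z'; rewrite mem_cat take_size_cat// => /orP[/mapP[u _ ->]|].
    by rewrite take_size_cat.
  by rewrite sE => /andP[_ zV] _ z'M z'E; rewrite mem_cat sE z'M eqxx z'E zV orbT.
Qed.

Lemma subgroup_supported L s : subgroup L -> subgroup (supported L s).
Proof.
move=> gL; apply/subgroupP; split.
- by split=> [||z _ _]; [exact: subgroup1|exact: fixes1|exact: section1].
- move=> x y [Lx xn xs] [Ly yn ys]; split; [exact: subgroupM|exact: fixesM|].
  by move=> z zn zs; rewrite (section_fixedM _ zn yn) xs// ys// mulg1.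
- move=> x [Lx xn xs]; split; [exact: subgroupV|exact: fixesV|].
  by move=> z zn zs; rewrite (section_fixedV zn xn) xs// invg1.
Qed.

Lemma supported_fixes L s : supported L s `<=` fixes (n + m).
Proof. by move=> g []. Qed.

Lemma supportedS L L' s : L `<=` L' -> supported L s `<=` supported L' s.
Proof. by move=> LL g [/LL]. Qed.

Lemma supported_nil L : subgroup L -> supported L [::] = [set 1].
Proof.
move=> gL; apply/seteqP; split=> [g [_ gn gs] /=|_ ->].
  by apply: (fixes_sections_eq1 hd gn) => z zn; exact: gs.
exact: subgroup1 (subgroup_supported _ gL).
Qed.

Lemma supported_full L s : (forall z, size z = n + m -> z \in s) ->
  supported L s = Stab L (level (n + m)).
Proof.
move=> sfull; apply/seteqP; split=> [g []//|g [Lg gn]]; split=> // z /sfull ->//.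
Qed.

Lemma supported_kernel L s x : size x = n + m -> x \notin s ->
  [set g | supported L (x :: s) g /\ section x g = 1] = supported L s.
Proof.
move=> xn xs; apply/seteqP; split=> g.
  move=> [[Lg gn gs] gx]; split=> // z zn zs; have [->//|zx] := EM (z = x).
  by apply: gs => //; rewrite inE negb_or zs andbT; apply/eqP.
move=> [Lg gn gs]; split; last exact: gs.
by split=> // z zn; rewrite inE negb_or => /andP[_ zs]; exact: gs.
Qed.

Lemma supported_section_morph L s x : size x = n + m ->
  {in supported L s &, {morph section x : g h / g^-1 * h}}.
Proof. by move=> xn; apply: (section_morph xn); exact: supported_fixes. Qed.

(** An element [y] of [G] is a section at [x] of some [h] in [L] that fixes
   level [n] and the whole block of [x]; conjugation by [h] preserves the
   vertices listed so far, and acts as conjugation by [y] on the section. *)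
Lemma supported_section_normal L s x y b : controlled n m L ->
  admissible (x :: s) -> G y -> (section x @` supported L (x :: s)) b ->
  (section x @` supported L (x :: s)) (y * b * y^-1).
Proof.
move=> [gL LG Lm] /= [sA xs xM xsat] Gy [g [Lg gM gs] <-].
pose v := take n x; pose w := drop n x.
have vn : size v = n by rewrite size_takel// xM leq_addr.
have wm : size w = m by rewrite size_drop xM addKn.
have xE : x = v ++ w by rewrite cat_take_drop.
(* lift y to an element of L fixing level n and the block of x *)
have [e [Ge em] ey] : (section w @` Stab G (level m)) y by rewrite (srG wm).
have [h [Lh hn] he] : (section v @` Stab L (level n)) e by apply: Lm.
have hblock z : size z = n + m -> take n z = v -> h z = z.
  move=> zM zv; rewrite -(cat_take_drop n z) zv sectionE hn// he em//.
  by rewrite /level /= size_drop zM addKn.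
have hx : h x = x by exact: hblock.
exists (h * g * h^-1); last first.
  by rewrite -[X in section X (h * g * h^-1)]hx section_conj ?gM// {1 3}xE section_cat he ey.
split; [exact: subgroup_conj|exact: fixes_conj|].
move=> z; rewrite -(autgVK h z); set u := h^-1 z; rewrite size_aut => uM hus.
rewrite section_conj ?gM// gs ?mulg1 ?mulgV//.
apply: contra hus; rewrite !inE => /orP[/eqP ->|us]; first by rewrite hx eqxx.
have [uv|nuv] := EM (take n u = v).
  by rewrite hblock// us orbT.
apply/orP; right; apply: (xsat u) => //; first by rewrite size_aut.
have un : size (take n u) = n by rewrite size_takel// uM leq_addr.
by rewrite -[X in h X](cat_take_drop n u) sectionE hn// take_size_cat.
Qed.

Lemma supported_section_dichotomy L s x : controlled n m L ->
  admissible (x :: s) ->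
  section x @` supported L (x :: s) `<=` [set 1] \/
  virtually_in G (section x @` supported L (x :: s)).
Proof.
move=> Lc sA; have [gL LG Lm] := Lc; have [_ _ xM _] := sA.
have [?|n1] := EM (section x @` supported L (x :: s) `<=` [set 1]); [by left|right].
apply: just_infinite => //.
- apply: (subgroup_section xM); first exact: subgroup_supported.
  exact: supported_fixes.
- by apply: section_image_sub => g [/LG].
- by move=> y b Gy; exact: supported_section_normal.
Qed.

Lemma finitely_generated1 : finitely_generated [set (1 : treeAut d)].
Proof.
apply/(finitely_generatedP subgroup_set1); exists [::] => // K gK _ _ ->.
exact: subgroup1.
Qed.

(** Each factor of the filtration is trivial or isomorphic to a finite index
   subgroup of [G]. *)
Lemma controlled_finitely_generated L : controlled n m L -> finitely_generated L.
Proof.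
move=> Lc; have [gL LG Lm] := Lc.
have [s sA sfull] := admissible_full.
apply: (finitely_generated_overgroup (subgroup_Stab (n + m) gL)) => //.
- exact: Stab_sub.
- rewrite -(supported_full _ sfull) => {sfull}.
  elim: s sA => [_|x s IHs sA]; first by rewrite supported_nil//; exact: finitely_generated1.
  have [sA' xs xM _] := sA.
  have gx : subgroup (section x @` supported L (x :: s)).
    apply: (subgroup_section xM); first exact: subgroup_supported.
    exact: supported_fixes.
  apply: (finitely_generated_extension (f := section x)) => //.
  + exact: subgroup_supported.
  + exact: supported_section_morph.
  + have [x1|Gx] := supported_section_dichotomy Lc sA.
      rewrite (_ : _ @` _ = [set 1]); first exact: finitely_generated1.
      by apply/seteqP; split=> // _ ->; exact: subgroup1.
    apply: (finitely_generated_finite_index gx gG) => //.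
    by apply: section_image_sub => g [/LG].
  + by rewrite supported_kernel//; exact: IHs.
- exact: virtually_in_Stab.
Qed.

Definition nontrivial_factor L s x : bool :=
  `[< ~ section x @` supported L (x :: s) `<=` [set 1] >].

(** A dimension for the subgroups containing a fixed large one: it increases
   with [L], strictly when the index is infinite, and is at most [size s]. *)
Fixpoint nfactors L s : nat :=
  if s is x :: s' then
    nontrivial_factor L s' x + nfactors L s'
  else 0.

Lemma nfactors_le_size L s : nfactors L s <= size s.
Proof. by elim: s => //= x s IHs; rewrite -add1n leq_add// leq_b1. Qed.

Lemma nfactor_le L L' s x : L `<=` L' ->
  nontrivial_factor L s x <= nontrivial_factor L' s x.
Proof.
move=> LL; rewrite /nontrivial_factor; case: asboolP => // L1; case: asboolP => // /contrapT L'1.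
by case: L1 => b [g /(supportedS LL) Lg <-]; apply: L'1; exists g.
Qed.

Lemma nfactors_le L L' s : L `<=` L' -> nfactors L s <= nfactors L' s.
Proof. by move=> LL; elim: s => //= x s IHs; rewrite leq_add// nfactor_le. Qed.

(** Equality forces each factor of [L] to have finite index in the matching
   factor of [L'], since both are trivial or both have finite index in [G]. *)
Lemma nfactors_eq_virtually_in L L' s : controlled n m L -> subgroup L' ->
  L' `<=` G -> L `<=` L' -> admissible s -> (forall z, size z = n + m -> z \in s) ->
  nfactors L s = nfactors L' s -> virtually_in L' L.
Proof.
move=> Lc gL' L'G LL sA sfull Es; have [gL LG Lm] := Lc.
suff : virtually_in (supported L' s) (supported L s).
  rewrite !supported_full// => /(virtually_in_trans (virtually_in_Stab (n + m) gL')).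
  by apply: virtually_in_sub => //; exact: Stab_sub.
move=> {sfull}; elim: s sA Es => [_ _|x s IHs sA].
  by rewrite !supported_nil//; exact/virtually_in_refl/subgroup_set1.
have [sA' xs xM _] := sA; move=> /= Es.
have le1 := nfactor_le s x LL; have le2 := nfactors_le s LL.
have [Ex {}Es] : nontrivial_factor L s x = nontrivial_factor L' s x :> nat /\
    nfactors L s = nfactors L' s.
  have := leq_add le1 (leqnn (nfactors L' s)); rewrite -Es leq_add2l => le3.
  have E2 : nfactors L s = nfactors L' s by apply/eqP; rewrite eqn_leq le2 le3.
  by split=> //; move: Es; rewrite E2 => /addIn.
apply: (virtually_in_extension (f := section x)).
- exact: subgroup_supported.
- exact: subgroup_supported.
- exact: supportedS.
- exact: supported_section_morph.
- have [x1|Gx] := supported_section_dichotomy Lc sA; last first.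
    by apply: virtually_in_sub Gx => //; apply: section_image_sub => g [/L'G].
  have x1' : section x @` supported L' (x :: s) `<=` [set 1].
    by move: Ex; rewrite /nontrivial_factor; do 2 case: asboolP => // ; move=> /contrapT.
  apply: virtually_in_sub (virtually_in_refl subgroup_set1) => // _ ->.
  by exists 1; [exact: subgroup1 (subgroup_supported _ gL)|exact: section1].
- by rewrite !supported_kernel//; exact: IHs.
Qed.

(** Conjugation by [c] and by its inverse are each required to send a finite
   index subgroup of [L] into [L]: this is equivalent to commensurability of
   [L] with its conjugate, and closure under products is immediate. *)
Definition commensurator L : set (treeAut d) := [set c | [/\ G c,
  virtually_in L [set k | L (c * k * c^-1)] &
  virtually_in L [set k | L (c^-1 * k * c)]]].

Lemma virtually_in_conj L H c : virtually_in L H ->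
  virtually_in [set k | L (c * k * c^-1)] [set k | H (c * k * c^-1)].
Proof.
move=> [I [e eP]]; exists I, (fun k => e (c * k * c^-1)) => x y Lx Ly exy /=.
have := eP _ _ Lx Ly exy; rewrite !invgM invgK !mulgA.
by rewrite mulgVK.
Qed.

Lemma subgroup_commensurator L : subgroup L -> subgroup (commensurator L).
Proof.
move=> gL.
have conjM a b : virtually_in L [set k | L (a * k * a^-1)] ->
    virtually_in L [set k | L (b * k * b^-1)] ->
    virtually_in L [set k | L ((a * b) * k * (a * b)^-1)].
  move=> La Lb; apply: (virtually_in_trans Lb).
  apply: virtually_in_sub (virtually_in_conj b La) => //.
  by move=> k /=; rewrite invgM !mulgA.
apply/subgroupP; split.
- have L1 : virtually_in L [set k | L (1 * k * 1^-1)].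
    apply: virtually_in_sub (virtually_in_refl gL) => //.
    by move=> k /=; rewrite invg1 mul1g mulg1.
  by split; [exact: subgroup1|exact: L1|move: L1; rewrite invg1].
- move=> a b [Ga La La'] [Gb Lb Lb']; split; [exact: subgroupM|exact: conjM|].
  by have := conjM b^-1 a^-1; rewrite -invgM !invgK; apply.
- by move=> a [Ga La La']; split; [exact: subgroupV|rewrite invgK|rewrite invgK].
Qed.

Lemma virtually_in_commensurator L L' : subgroup L' -> L' `<=` G -> L `<=` L' ->
  virtually_in L' L -> L' `<=` commensurator L.
Proof.
move=> gL' L'G LL L'L.
have Lc c : L' c -> virtually_in L [set k | L (c * k * c^-1)].
  move=> L'c; apply: virtually_in_sub (virtually_in_conj c L'L) => //.
  by move=> k /LL L'k /=; exact: subgroup_conj.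
move=> c L'c; split; [exact: L'G|exact: Lc|].
by have := Lc _ (subgroupV gL' L'c); rewrite invgK.
Qed.

(** If a factor becomes nontrivial in the commensurator because of [c], then
   the commutators of [c] with a finite index subgroup of [L] lie in [L], hence
   in a trivial factor, so that a section of [c] centralizes a large group. *)
Lemma nfactors_commensurator L s : controlled n m L -> admissible s ->
  nfactors (commensurator L) s = nfactors L s.
Proof.
move=> Lc; have [gL LG Lm] := Lc.
have LC : L `<=` commensurator L.
  by apply: virtually_in_commensurator => //; exact: virtually_in_refl.
elim: s => [//|x s IHs] /= [sA xs xM _]; rewrite IHs//; congr (nat_of_bool _ + _).
apply/idP/idP => /asboolP; last first.
  move=> L1; apply/asboolP => C1; apply: L1 => b [g /(supportedS LC) Cg <-].
  by apply: C1; exists g.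
move=> C1; apply/asboolP => L1; apply: C1 => _ [c [[Gc cL _] cM cs] <-] /=.
pose A := Stab L (level (n + m)) `&` [set k | L (c * k * c^-1)].
have GA : virtually_in G (section x @` A).
  apply: (virtually_in_trans (controlled_large Lc xM)).
  apply: virtually_in_image; first exact: (section_morph xM (@Stab_fixes _ _ _)).
  apply: virtually_inI; first exact/virtually_in_refl/subgroup_Stab.
  by apply: virtually_in_sub cL => // g [].
apply: (trivial_centralizer GA); first exact: section_in.
move=> _ [k [[Lk kM] Lck] <-].
have ckM : fixes (n + m) (c * k * c^-1) by exact: fixes_conj.
have sck z : size z = n + m -> section z (c * k * c^-1 * k^-1) =
    section z c * section z k * (section z c)^-1 * (section z k)^-1.
  move=> zM; rewrite (section_fixedM _ zM (fixesV kM)) (section_fixedV zM kM).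
  rewrite (section_fixedM _ zM (fixesV cM)) (section_fixedV zM cM).
  by rewrite (section_fixedM _ zM kM).
have : section x (c * k * c^-1 * k^-1) = 1.
  apply: L1; exists (c * k * c^-1 * k^-1) => //; split.
  - by apply: subgroupM => //; exact: subgroupV.
  - by apply: fixesM => //; exact: fixesV.
  - by move=> z zM zs; rewrite sck// cs// invg1 mulg1 mul1g mulgV.
rewrite sck// => E; apply: (mulIg (section x c)^-1); apply: (mulIg (section x k)^-1).
by rewrite E mulgK mulgV.
Qed.

(** [P] generates [L] and [Q] consists of representatives of the nontrivial
   cosets of [L] in its commensurator. An overgroup of [L] with the same number
   of factors has [L] as a subgroup of finite index, so lies in the
   commensurator, and contains a member of [Q] unless it is [L]. *)
Lemma controlled_isolated L s : controlled n m L -> admissible s ->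
  (forall z, size z = n + m -> z \in s) ->
  exists P Q : seq (treeAut d), [/\ forall g, g \in P -> L g,
    forall g, g \in Q -> G g /\ ~ L g &
    forall L', subgroup L' -> L' `<=` G -> (forall g, g \in P -> L' g) ->
      (forall g, g \in Q -> ~ L' g) ->
      controlled n m L' /\ (L' <> L -> nfactors L s < nfactors L' s)].
Proof.
move=> Lc sA sfull; have [gL LG Lm] := Lc.
have [P PL LP] := (finitely_generatedP gL).1 (controlled_finitely_generated Lc).
have LC : L `<=` commensurator L.
  by apply: virtually_in_commensurator => //; exact: virtually_in_refl.
have /virtually_in_repr[I [c [r [rP cP]]]] : virtually_in (commensurator L) L.
  apply: (nfactors_eq_virtually_in Lc _ _ _ sA) => //.
    exact: subgroup_commensurator.
    by move=> g [].
  by rewrite nfactors_commensurator.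
exists P, [seq g <- [seq r i | i : I] | `[< G g /\ ~ L g >]]; split=> //.
  by move=> x; rewrite mem_filter => /andP[/asboolP].
move=> L' gL' L'G PL' QL'; have LL : L `<=` L' by exact: LP.
split; first exact: controlledS Lc.
move=> L'L; rewrite ltn_neqAle nfactors_le// andbT; apply/eqP => E.
have L'C : L' `<=` commensurator L.
  apply: virtually_in_commensurator => //.
  exact: (nfactors_eq_virtually_in Lc _ _ _ sA).
apply: L'L; apply/seteqP; split=> // x L'x; apply: contrapT => nLx.
have Cx := L'C _ L'x; have [Cr cr] := rP _ Cx.
have Lrx := cP _ _ Cr Cx cr.
have rE : r (c x) = x * ((r (c x))^-1 * x)^-1 by rewrite invgM invgK mulgA mulgV mul1g.
apply: (QL' (r (c x))).
  rewrite mem_filter map_f ?mem_enum// andbT; apply/asboolP; split.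
    by case: Cr.
  move=> Lr; apply: nLx; have -> : x = r (c x) * ((r (c x))^-1 * x).
    by rewrite mulgA mulgV mul1g.
  exact: subgroupM.
by rewrite rE; apply: subgroupM => //; apply: (subgroupV gL'); exact: LL.
Qed.

End Filtration.

(** * Large subgroups have finite Cantor-Bendixson rank *)

(** By induction on [r], the subgroups [L] above [K] whose number of factors is
   within [r] of the maximum are removed by [r] derivatives. *)
Lemma large_not_cb_derivative n K : subgroup K -> K `<=` G -> large n K ->
  exists r, ~ cb_derivative (subgroup_space G) (fin r) (indicator G K).
Proof.
move=> gK KG /(large_controlled gK KG)[m Kc].
have [s sA sfull] := admissible_full n m.
have rank r : forall L, controlled n m L -> size s < nfactors n m L s + r ->
    ~ cb_derivative (subgroup_space G) (fin r) (indicator G L).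
  elim: r => [|r IHr] L Lc.
    by rewrite addn0 ltnNge nfactors_le_size.
  rewrite addnS ltnS => sr; have [gL LG _] := Lc.
  have [P [Q [PL QL iso]]] := controlled_isolated Lc sA sfull.
  apply: (not_derived PL QL) => //; first exact: cb_derivative_sub.
  move=> L' [gL' L'G] L'r PL' QL'; have [L'c lt] := iso L' gL' L'G PL' QL'.
  apply: contrapT => /lt {}lt; apply: IHr L'c _ L'r.
  by apply: leq_ltn_trans sr _; rewrite ltn_add2r.
by exists (size s).+1; apply: rank => //; rewrite addnS ltnS leq_addl.
Qed.

(** * The other subgroups form a set without isolated points *)

Lemma eventually_agree K (L : nat -> set (treeAut d)) (F : seq (treeAut d)) :
  (forall j, K `<=` L j) ->
  (forall g, ~ K g -> exists j0, forall j, j0 <= j -> ~ L j g) ->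
  exists j0, forall j, j0 <= j -> forall g, g \in F -> (L j g <-> K g).
Proof.
move=> KL ev; elim: F => [|x F [j0 IHF]]; first by exists 0.
have [j1 xj] : exists j1, forall j, j1 <= j -> (L j x <-> K x).
  have [Kx|nKx] := EM (K x); first by exists 0 => j _; split=> // _; exact: KL.
  by have [j1 xj] := ev x nKx; exists j1 => j /xj nL; split.
exists (maxn j0 j1) => j; rewrite geq_max => /andP[j0j j1j] g.
by rewrite inE => /orP[/eqP ->|]; [exact: xj|exact: IHF].
Qed.

Section TrivialSection.
Variables (n : nat) (K : set (treeAut d)) (v : vertex d).
Hypotheses (gK : subgroup K) (KG : K `<=` G) (vn : size v = n).
Hypothesis Kv : section v @` Stab K (level n) `<=` [set 1].

Let x0 : 'I_d := Ordinal (ltnW hd).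

Definition deep j : vertex d := v ++ nseq j x0.

Definition orbit_of j z : Prop := exists2 h, K h & h (deep j) = z.

(** The group added to [K]: normalized by [K], close to the identity, and
   supported where [Stab K (level n)] acts trivially. *)
Definition orbit_supported j : set (treeAut d) := [set a | [/\ G a,
  fixes (n + j) a & forall z, size z = n + j -> ~ orbit_of j z -> section z a = 1]].

Definition enlarged j : set (treeAut d) :=
  [set g | exists2 k, K k & orbit_supported j (k^-1 * g)].

Lemma size_deep j : size (deep j) = (n + j)%N.
Proof. by rewrite size_cat size_nseq vn. Qed.

Lemma subgroup_orbit_supported j : subgroup (orbit_supported j).
Proof.
apply/subgroupP; split.
- by split=> [||z _ _]; [exact: subgroup1|exact: fixes1|exact: section1].
- move=> a b [Ga an az] [Gb bn bz]; split; [exact: subgroupM|exact: fixesM|].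
  by move=> z zn zo; rewrite (section_fixedM _ zn bn) az// bz// mulg1.
- move=> a [Ga an az]; split; [exact: subgroupV|exact: fixesV|].
  by move=> z zn zo; rewrite (section_fixedV zn an) az// invg1.
Qed.

Lemma orbit_supported_conj j k a : K k -> orbit_supported j a ->
  orbit_supported j (k * a * k^-1).
Proof.
move=> Kk [Ga an az]; split; [exact: subgroup_conj (KG Kk) Ga|exact: fixes_conj|].
move=> z; rewrite -(autgVK k z); set u := k^-1 z; rewrite size_aut => un uo.
rewrite section_conj ?an// az ?mulg1 ?mulgV//.
by move=> [h Kh hu]; apply: uo; exists (k * h); [exact: subgroupM|rewrite -hu].
Qed.

Lemma subgroup_enlarged j : subgroup (enlarged j).
Proof.
have gN := subgroup_orbit_supported j.
apply/subgroupP; split.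
- exists 1; first exact: subgroup1.
  by rewrite invg1 mulg1; exact: subgroup1.
- move=> g h [k Kk Nk] [l Kl Nl]; exists (k * l); first exact: subgroupM.
  have -> : (k * l)^-1 * (g * h) = l^-1 * (k^-1 * g) * l^-1^-1 * (l^-1 * h).
    by rewrite invgM invgK !mulgA mulgK.
  by apply: subgroupM => //; apply: orbit_supported_conj => //; exact: subgroupV.
- move=> g [k Kk Nk]; exists k^-1; first exact: subgroupV.
  have -> : k^-1^-1 * g^-1 = k * (k^-1 * g)^-1 * k^-1.
    by rewrite invgM !invgK -!mulgA mulgV mulg1.
  by apply: orbit_supported_conj => //; exact: subgroupV.
Qed.

Lemma sub_enlarged j : K `<=` enlarged j.
Proof.
move=> k Kk; exists k => //; rewrite mulVg.
exact: subgroup1 (subgroup_orbit_supported j).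
Qed.

Lemma enlarged_sub j : enlarged j `<=` G.
Proof.
move=> g [k /KG Gk [Gkg _ _]]; have -> : g = k * (k^-1 * g) by rewrite mulgA mulgV mul1g.
exact: subgroupM.
Qed.

Lemma section_orbit h k : K h -> Stab K (level n) k -> section (h v) k = 1.
Proof.
move=> Kh [Kk kn]; have hkn : fixes n (h^-1 * k * h^-1^-1) by exact: fixes_conj.
have Khk := subgroup_conj gK (subgroupV gK Kh) Kk.
have := section_conj h (hkn v vn).
rewrite (Kv (_ : (section v @` Stab K (level n)) (section v (h^-1 * k * h^-1^-1)))).
  by rewrite mulg1 mulgV invgK !mulgA mulgV mul1g mulgK.
by exists (h^-1 * k * h^-1^-1).
Qed.

(** [Stab K (level n)] acts trivially below the orbit of [v], where all the
   groups [orbit_supported j] live. *)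
Lemma orbit_supported_disjoint i j a b : orbit_supported i a ->
  orbit_supported j b -> K (a * b^-1) -> a = b.
Proof.
have out e c z : orbit_supported e c -> size z = n ->
    ~ (exists2 h, K h & h v = z) -> fixes n c /\ section z c = 1.
  move=> [Gc ce cz] zn zo; split; first exact: (fixes_le hd (leq_addr _ _) ce).
  apply: (fixes_sections_eq1 hd (fixes_section hd zn ce)) => q qe.
  rewrite -section_cat; apply: cz; first by rewrite size_cat zn qe.
  move=> [h Kh]; rewrite sectionE => /(congr1 (take n)).
  by rewrite !take_size_cat ?size_aut// => hz; apply: zo; exists h.
move=> Na Nb Kab.
have an : fixes n a by case: Na => _ ae _; exact: (fixes_le hd (leq_addr _ _) ae).
have bn : fixes n b by case: Nb => _ be _; exact: (fixes_le hd (leq_addr _ _) be).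
have abn : fixes n (a * b^-1) by apply: fixesM => //; exact: fixesV.
apply: (mulIg b^-1); rewrite mulgV; apply: (fixes_sections_eq1 hd abn) => z zn.
have [[h Kh <-]|zo] := EM (exists2 h, K h & h v = z).
  exact: section_orbit.
rewrite (section_fixedM _ zn (fixesV bn)) (section_fixedV zn bn).
by rewrite (out _ _ _ Na zn zo).2 (out _ _ _ Nb zn zo).2 mulgV.
Qed.

Lemma enlarged_limit g : ~ K g -> exists j0, forall j, j0 <= j -> ~ enlarged j g.
Proof.
move=> nKg; have [[i [k Kk Nk]]|/forallNP nL] := EM (exists i, enlarged i g); last first.
  by exists 0 => j _; exact: nL.
have /neq1_moves[w aw] : k^-1 * g <> 1.
  by move=> /(congr1 (mul k)); rewrite mulgA mulgV mul1g mulg1 => gk; apply: nKg; rewrite gk.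
exists (size w) => j wj [l Kl Nl]; apply: aw.
have Kkl : K (k^-1 * g * (l^-1 * g)^-1).
  rewrite invgM invgK !mulgA mulgK; apply: subgroupM => //; exact: subgroupV.
rewrite (orbit_supported_disjoint Nk Nl Kkl); case: Nl => _ le _.
by apply: (fixes_le hd _ le erefl); rewrite (leq_trans wj)// leq_addl.
Qed.

Lemma enlarged_neq j : enlarged j <> K.
Proof.
have [|a [Ra _ a1]] := @Rist_meets G (deep j); first exact: virtually_in_refl.
have Na : orbit_supported j a.
  split; [by case: Ra|by rewrite -size_deep; exact: Rist_fixes Ra|].
  move=> z zn zo; apply: (Rist_section Ra); rewrite ?size_deep// => zE.
  by apply: zo; exists 1; [exact: subgroup1|rewrite zE].
have N1 : orbit_supported j 1 by exact: subgroup1 (subgroup_orbit_supported j).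
move=> LK; apply: a1; apply: (orbit_supported_disjoint Na N1).
rewrite invg1 mulg1 -LK; exists 1; first exact: subgroup1.
by rewrite invg1 mul1g.
Qed.

(** The orbits of [K] below [v] have bounded size while the levels grow, so a
   deep enough subtree is missed and [enlarged j] acts trivially on it. *)
Lemma enlarged_not_large : exists j0, forall j, j0 <= j -> forall l, ~ large l (enlarged j).
Proof.
have [I [c cP]] := virtually_in_fixes K n.
exists #|I| => j Ij l Ll.
have [u uj uo] : exists2 u, size u = j & ~ orbit_of j (v ++ u).
  apply: contrapT => /forall2NP noU.
  have /choice[f fP] (t : j.-tuple 'I_d) : exists h, K h /\ h (deep j) = v ++ t.
    have [/(_ (size_tuple t))//|/contrapT[h Kh ht]] := noU t.
    by exists h.
  have : injective (c \o f).
    move=> t t' /= cE; apply: val_inj.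
    have [Kt tE] := fP t; have [Kt' t'E] := fP t'.
    have ftn : fixes n ((f t)^-1 * f t') by exact: cP.
    have ft1 : section v ((f t)^-1 * f t') = 1.
      apply: Kv; exists ((f t)^-1 * f t') => //; split=> //.
      by apply: subgroupM => //; exact: subgroupV.
    have : ((f t)^-1 * f t') (deep j) = deep j by rewrite sectionE ft1 ftn.
    change ((f t)^-1 (f t' (deep j)) = deep j -> val t = val t').
    move=> /(congr1 (f t)); rewrite autgVK tE t'E => /(congr1 (drop n)).
    by rewrite !drop_size_cat.
  move=> /leq_card; rewrite card_tuple card_ord => djI.
  by have := leq_trans (ltn_expl j hd) (leq_trans djI Ij); rewrite ltnn.
have trivial_q : section (v ++ u) @` Stab (enlarged j) (level (n + j)) `<=` [set 1].
  move=> _ [g [[k Kk [Ga an az]] gn] <-] /=.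
  have uM : size (v ++ u) = (n + j)%N by rewrite size_cat vn uj.
  have kE : k = g * (k^-1 * g)^-1 by rewrite invgM invgK mulgA mulgV mul1g.
  have kn : fixes n k.
    by apply: (fixes_le hd (leq_addr j n)); rewrite kE; apply: fixesM => //; exact: fixesV.
  have -> : g = k * (k^-1 * g) by rewrite mulgA mulgV mul1g.
  rewrite (section_fixedM _ uM an) az// mulg1 section_cat (_ : section v k = 1).
    exact: section1.
  by apply: Kv; exists k.
have := large_le (subgroup_enlarged j) (@enlarged_sub j) (leq_addl (n + j) l) Ll.
move=> /(_ ((v ++ u) ++ nseq l x0)); rewrite !size_cat vn uj size_nseq => /(_ erefl).
apply: not_virtually_in1; exact: sections_trivial_cat trivial_q.
Qed.

Lemma trivial_section_limit (F : seq (treeAut d)) : exists L, [/\ subgroup L, L `<=` G,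
  forall l, ~ large l L, L <> K & forall g, g \in F -> (L g <-> K g)].
Proof.
have [j0 notlarge] := enlarged_not_large.
have [j1 agree] := eventually_agree F sub_enlarged enlarged_limit.
exists (enlarged (maxn j0 j1)); split.
- exact: subgroup_enlarged.
- exact: enlarged_sub.
- by apply: notlarge; exact: leq_maxl.
- exact: enlarged_neq.
- by apply: agree; exact: leq_maxr.
Qed.

End TrivialSection.
Lemma not_large_limit K (F : seq (treeAut d)) : subgroup K -> K `<=` G -> (forall l, ~ large l K) ->
  exists L, [/\ subgroup L, L `<=` G, forall l, ~ large l L, L <> K &
                forall g, g \in F -> (L g <-> K g)].
Proof.
move=> gK KG nK; have [fgK|nfgK] := EM (finitely_generated K).
  have [n Kn] := finitely_generated_trivial_or_large gK KG fgK.
  have /existsNP[v /not_implyP[vn nKv]] := nK n.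
  have [Kv|//] := Kn v vn; exact: (trivial_section_limit gK KG vn Kv).
exists (generated ([set` F] `&` K)).
have gsub : generated ([set` F] `&` K) `<=` K by apply: generated_min => // g [].
split.
- exact: subgroup_generated.
- by move=> g /gsub/KG.
- by move=> l /(largeS gsub)/nK.
- move=> E; apply: nfgK; rewrite -E; exists ([set` F] `&` K) => //.
  exact/finite_setIl/finite_seq.
- by move=> g gF; split=> [/gsub//|Kg]; apply: generatedW.
Qed.

(** * Subgroups of arbitrarily large finite rank *)

Section Twins.
Variables (x0 x1 : 'I_d) (r : nat).
Hypothesis x01 : x0 <> x1.
Implicit Types kappa : vertex d -> nat -> Prop.

(** With [kappa w] always true this is a diagonal subgroup at the twin vertices
   [x0 :: w] and [x1 :: w]; otherwise [kappa w] selects the levels on which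
   the diagonal condition is kept. *)
Definition twins kappa : set (treeAut d) := [set g | [/\ G g, fixes (1 + r) g &
  forall w u, size w = r -> kappa w (size u) ->
    section (x0 :: w) g u = section (x1 :: w) g u]].

Lemma subgroup_twins kappa : subgroup (twins kappa).
Proof.
have sz y w : size w = r -> size ((y : 'I_d) :: w) = (1 + r)%N by move=> /= ->.
apply/subgroupP; split.
- by split=> [||w u _ _]; [exact: subgroup1|exact: fixes1|rewrite !section1].
- move=> g h [Gg gr gk] [Gh hr hk]; split; [exact: subgroupM|exact: fixesM|].
  move=> w u wr ku; rewrite !(section_fixedM _ (sz _ _ wr) hr).
  change (section (x0 :: w) g (section (x0 :: w) h u) =
          section (x1 :: w) g (section (x1 :: w) h u)).
  by rewrite hk// gk// size_aut.
- move=> g [Gg gr gk]; split; [exact: subgroupV|exact: fixesV|].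
  move=> w u wr ku; rewrite !(section_fixedV (sz _ _ wr) gr).
  apply: (@aut_inj _ (section (x0 :: w) g)); rewrite autgVK gk//; last by rewrite size_aut.
  by rewrite autgVK.
Qed.

Lemma twins_sub kappa : twins kappa `<=` G.
Proof. by move=> g []. Qed.

(** Each [w] at which the twin sections are required to coincide accounts for
   one more derivative: weaken this to agreement up to length [j], and let [j]
   go to infinity. *)
Lemma twins_cb_derivative (W : seq (vertex d)) kappa : uniq W ->
  (forall w, w \in W -> size w = r /\ forall l, kappa w l) ->
  cb_derivative (subgroup_space G) (fin (size W)) (indicator G (twins kappa)).
Proof.
elim: W kappa => [|w0 W IHW] kappa.
  move=> _ _; apply: subgroup_space_indicator.
  by split; [exact: subgroup_twins|exact: twins_sub].
move=> /= /andP[w0W uW] Wk.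
have [w0r kw0] : size w0 = r /\ forall l, kappa w0 l by apply: Wk; rewrite inE eqxx.
have Wk' w : w \in W -> size w = r /\ forall l, kappa w l.
  by move=> wW; apply: Wk; rewrite inE wW orbT.
pose kap j w l := kappa w l /\ (w = w0 -> l <= j).
apply: derived_limit; first exact: twins_sub.
  exact: IHW.
have subj j : twins kappa `<=` twins (kap j).
  by move=> g [Gg gr gk]; split=> // w u wr [ku _]; exact: gk.
have limj g : ~ twins kappa g -> exists j0, forall j, j0 <= j -> ~ twins (kap j) g.
  move=> ng; have [[Gg gr]|nGg] := EM (G g /\ fixes (1 + r) g); last first.
    by exists 0 => j _ [Gg gr _]; apply: nGg.
  have [w [u [wr ku gu]]] : exists w u, [/\ size w = r, kappa w (size u) &
      section (x0 :: w) g u <> section (x1 :: w) g u].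
    apply: contrapT => nwu; apply: ng; split=> // w u wr ku.
    by apply: contrapT => gu; apply: nwu; exists w, u.
  by exists (size u) => j uj [_ _ /(_ w u wr)]; apply: contra_not gu; apply.
move=> F; have [j jF] := eventually_agree F subj limj.
exists (twins (kap j)); split.
- exact: twins_sub.
- apply: IHW => // w wW; have [wr kw] := Wk' w wW; split=> // l; split=> // ww0.
  by move: w0W; rewrite -ww0 wW.
- have [a [Ra aj a1]] := @Rist_meets (fixes (1 + r + j)) (x0 :: w0) (virtually_in_fixes G _).
  have sz y w : size w = r -> size ((y : 'I_d) :: w) = size (x0 :: w0).
    by move=> wr /=; rewrite wr w0r.
  have a_x1 w : size w = r -> section (x1 :: w) a = 1.
    by move=> wr; apply: (Rist_section Ra); [exact: sz|case=> /esym].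
  move=> E; have : twins kappa a.
    rewrite -E; split; [by case: Ra|exact: (fixes_le hd (leq_addr _ _) aj)|].
    move=> w u wr [_ wj]; rewrite a_x1//; have [ww0|nww0] := EM (w = w0).
      apply: (fixes_le hd (wj ww0)) (erefl _).
      by apply: (fixes_section hd _ aj); rewrite /= wr.
    by rewrite (Rist_section Ra)//; [exact: sz|case].
  move=> [_ _ ak]; apply: a1; apply: (fixes_sections_eq1 hd (Rist_fixes Ra)) => z zM.
  have [->|nz] := EM (z = x0 :: w0); last exact: Rist_section Ra _ _.
  by apply: treeAut_ext => u; rewrite ak// a_x1.
- by move=> g gF _; apply: jF.
Qed.

(** The section is normal in [G] since elements of [G] lift to elements fixing
   [v], which normalize the rigid stabilizer of [v]. *)
Lemma Rist_section_large v : virtually_in G (section v @` Rist G v).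
Proof.
have gR := subgroup_Rist v gG.
apply: just_infinite.
- by apply: (subgroup_section erefl) => // g /Rist_fixes.
- by apply: section_image_sub => g [].
- move=> y b Gy [g Rg <-].
  have [h [Gh hv] hy] : (section v @` Stab G (level (size v))) y by rewrite srG.
  exists (h * g * h^-1); first by rewrite -[X in Rist G X](hv v erefl); exact: Rist_conj.
  rewrite -[X in section X (h * _ * _)](hv v erefl) section_conj ?hy//.
  exact: (Rist_fixes Rg).
- have [a [Ra _ a1]] := @Rist_meets G v (virtually_in_refl gG).
  move=> /(_ (section v a)) R1; apply: a1.
  apply: (fixes_sections_eq1 hd (Rist_fixes Ra)) => z zv.
  have [->|nz] := EM (z = v); last exact: Rist_section Ra _ _.
  by apply: R1; exists a.
Qed.

(** Below a vertex of level 1 other than [x0] and [x1] the group contains rigid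
   stabilizers; below [x0] and [x1] it contains the diagonal copy of the
   intersection [A] of the sections of the two rigid stabilizers. *)
Lemma twins_large : large (1 + r) (twins (fun _ _ => True)).
Proof.
move=> [//|x w] /= [wr]; have {}wr : size w = r by [].
have [[x0x x1x]|xtwin] := EM (x0 <> x /\ x1 <> x).
  apply: virtually_in_sub (Rist_section_large (x :: w)) => // _ [g Rg <-].
  have gr : fixes (1 + r) g by rewrite -wr; exact: Rist_fixes Rg.
  exists g => //; split=> //; split=> //; first by case: Rg.
  move=> z u zr _; rewrite !(Rist_section Rg) /= ?zr ?wr//; by case.
pose A := (section [:: x0] @` Rist G [:: x0]) `&` (section [:: x1] @` Rist G [:: x1]).
have GA : virtually_in G A by apply: virtually_inI; exact: Rist_section_large.
apply: virtually_in_sub (section_virtually_in wr GA) => //.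
move=> _ [_ [[[g0 R0 <-] [g1 R1 g10]] [Ga ar]] <-].
move: g10 Ga ar; set a := section [:: x0] g0 => g10 Ga ar.
have f0 : fixes 1 g0 by exact: (Rist_fixes R0).
have f1 : fixes 1 g1 by exact: (Rist_fixes R1).
have sg y : section [:: y] (g0 * g1) = section [:: y] g0 * section [:: y] g1.
  exact: (@section_fixedM _ 1 g0 g1 [:: y] erefl f1).
have sg0 : section [:: x0] (g0 * g1) = a.
  by rewrite sg (Rist_section R1) ?mulg1//; case.
have sg1 : section [:: x1] (g0 * g1) = a.
  by rewrite sg (Rist_section R0) ?mul1g//; case=> /esym.
have gtw : twins (fun _ _ => True) (g0 * g1).
  split.
  - by apply: subgroupM => //; [case: R0|case: R1].
  - move=> [//|y z] [zr]; have {}zr : size z = r by [].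
    rewrite -cat1s sectionE (fixesM f0 f1)//.
    have [->|ny0] := EM (y = x0); first by rewrite sg0 ar.
    have [->|ny1] := EM (y = x1); first by rewrite sg1 ar.
    by rewrite sg (Rist_section R0) ?(Rist_section R1) ?mulg1//; case.
  - by move=> z u _ _; rewrite -(cat1s x0) -(cat1s x1) !section_cat sg0 sg1.
have [xE|xE] : x0 = x \/ x1 = x.
- by apply: contrapT => /not_orP.
- exists (g0 * g1); first by split=> //; case: gtw.
  by rewrite -xE -cat1s section_cat sg0.
- exists (g0 * g1); first by split=> //; case: gtw.
  by rewrite -xE -cat1s section_cat sg1.
Qed.

End Twins.

Lemma large_of_high_rank r : exists n K, [/\ subgroup K, K `<=` G, large n K &
  cb_derivative (subgroup_space G) (fin r) (indicator G K)].
Proof.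
pose x0 : 'I_d := Ordinal (ltnW hd); pose x1 : 'I_d := Ordinal hd.
have x01 : x0 <> x1 by move=> /(congr1 val).
exists (1 + r)%N, (twins x0 x1 r (fun _ _ => True)); split.
- exact: subgroup_twins.
- exact: twins_sub.
- exact: twins_large.
have r_words : r <= size (words r : seq (vertex d)).
  by rewrite size_map -cardE card_tuple card_ord ltnW// ltn_expl.
rewrite -[r in fin r](size_takel r_words); apply: twins_cb_derivative => //.
  exact/take_uniq/uniq_words.
by move=> w /mem_take; rewrite mem_words => /eqP.
Qed.

Lemma cb_rank_subgroup_space : has_cb_rank (subgroup_space G) omega.
Proof.
pose P : set {ptws G -> bool} :=
  [set f | subgroup_space G f /\ forall n, ~ large n (carrier f)].
apply: (has_cb_rank_omega (P := P)).
- by move=> f [].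
- move=> f [gf nf]; rewrite -(carrierK f); apply: derived_limit.
  + exact: carrier_sub.
  + by rewrite carrierK.
  + move=> F; have [L [gL LG nL LK LF]] := not_large_limit F gf (@carrier_sub _ _ f) nf.
    exists L; split=> // [|g gF _]; last exact: LF.
    by split; [exact: subgroup_space_indicator|rewrite indicatorK].
- move=> f gf nPf; have [n fn] : exists n, large n (carrier f).
    by apply: contrapT => /forallNP nf; apply: nPf.
  have := large_not_cb_derivative gf (@carrier_sub _ _ f) fn.
  by rewrite carrierK.
- move=> r; have [n [K [gK KG Kn Kr]]] := large_of_high_rank r.
  by exists (indicator G K) => // -[_ /(_ n)]; rewrite indicatorK.
Qed.

End Branch.

Theorem proposition3p21 (d : nat) (hd : 2 <= d) (G : set (treeAut d))
    (subgroup_G : subgroup G)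
    (fg_G : finitely_generated G)
    (self_similar_G : self_similar G)
    (sssr_G : super_strongly_self_replicating G)
    (branch_G : branch G)
    (sip_G : subgroup_induction_property G)
    (csp_G : congruence_subgroup_property G) :
  has_cb_rank (subgroup_space G) omega.
Proof. exact: cb_rank_subgroup_space. Qed.
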